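(* Let $n\ge 2$ and $1\le k,l\le n$. (i) If $k$ divides $n$, then $\kappa_{\mathbb G_n}(0;e_k)=\rho_n(e_k)$. Consequently, if also $l$ divides $n$, then $\hat\kappa_{\mathbb G_n}(0;X)=\gamma_{\mathbb G_n}(0;X)=\rho_n(X)$ for $X\in L_{k,l}$. (ii) If $n\ge 3$ and $X\in L_{1,n}\setminus(L_{1,1}\cup L_{n,n})$, then $\kappa_{\mathbb G_n}(0;X)>\rho_n(X)$. (iii) If $k$ does not divide $n$, then $\gamma_{\mathbb G_n}(0;e_k)>\rho_n(e_k)$.
   Context: Let $\mathbb D$ be the open unit disc and $\sigma=(\sigma_1,\dots,\sigma_n):\mathbb C^n\to\mathbb C^n$, $\sigma_k(z_1,\dots,z_n)=\sum_{1\le j_1<\dots<j_k\le n}z_{j_1}\cdots z_{j_k}$. The symmetrized polydisc is $\mathbb G_n=\sigma(\mathbb D^n)$ (it contains $0$). $e_1,\dots,e_n$ is the standard basis of $\mathbb C^n$; $L_{k,l}=\mathrm{span}(e_k,e_l)$ (complex span; $L_{k,k}=\mathbb Ce_k$). For $X=\sum_{j=1}^nX_je_j$, $$\rho_n(X)=\max_{|\lambda|=1}\left|\frac1n\sum_{j=1}^n jX_j\lambda^{j-1}\right|.$$ For a domain $D\subset\mathbb C^n$, $z\in D$, $X\in\mathbb C^n$: the Carathéodory metric is $\gamma_D(z;X)=\sup\{|f'(z)X|:f\in\mathcal O(D,\mathbb D),\ f(z)=0\}$; the Kobayashi metric is $\kappa_D(z;X)=\inf\{|\alpha|:\exists f\in\mathcal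 O(\mathbb D,D),\ f(0)=z,\ \alpha f'(0)=X\}$; the Kobayashi--Buseman metric $\hat\kappa_D(z;\cdot)$ is the largest pseudonorm not exceeding $\kappa_D(z;\cdot)$. *)

(* Defs.v *)
From HB Require Import structures.
From mathcomp Require Import all_boot all_order all_algebra.
From mathcomp Require Export complex.
From mathcomp Require Import all_classical all_reals all_analysis.

Set Implicit Arguments.
Unset Strict Implicit.
Unset Printing Implicit Defensive.

Import Order.TTheory GRing.Theory Num.Theory.
Import numFieldNormedType.Exports.

Local Open Scope classical_set_scope.
Local Open Scope ring_scope.

(* R[i] as a normed module over itself, exactly as numFieldNormedType.Exports
   does for abstract numeric fields; C^n is then 'rV[R[i]]_n. *)
Section ComplexNormedModule.
Variable R : realType.
#[non_forgetful_inheritance]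
HB.instance Definition _ := GRing.ComAlgebra.copy R[i] R[i]^o.
#[non_forgetful_inheritance]
HB.instance Definition _ := Vector.copy R[i] R[i]^o.
#[non_forgetful_inheritance]
HB.instance Definition _ := NormedModule.copy R[i] R[i]^o.
End ComplexNormedModule.

(* [`|z|] lives in R[i]; the modulus as a real number is [normc z : R]. *)
Notation normc := ComplexField.Normc.normc.

Section SymmetrizedPolydisc.
Variables (R : realType) (n : nat).
Local Notation C := R[i].

Definition unit_disc : set C := [set z | normc z < 1].

Definition polydisc : set 'rV[C]_n := [set z | forall j, unit_disc (z 0 j)].

(* Columns are indexed from 0, so column k holds the elementary symmetric
   polynomial of degree k + 1. *)
Definition sigma (z : 'rV[C]_n) : 'rV[C]_n :=
  \row_(k < n) \sum_(A : {set 'I_n} | #|A| == k.+1) \prod_(j in A) z 0 j.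

Definition symmetrized_polydisc : set 'rV[C]_n := sigma @` polydisc.

(* 1-based: e 1, ..., e n is the standard basis. *)
Definition e (k : nat) : 'rV[C]_n := \row_(j < n) (j.+1 == k)%:R.

Definition L (k l : nat) : {vspace 'rV[C]_n} := <<[:: e k; e l]>>%VS.

(* The maximum over the unit circle (attained, by compactness) as a supremum. *)
Definition rho (X : 'rV[C]_n) : R :=
  sup [set normc (n%:R^-1 * \sum_(j < n) j.+1%:R * X 0 j * lambda ^+ j)
      | lambda in [set lambda : C | normc lambda = 1]].

End SymmetrizedPolydisc.

Arguments unit_disc R : clear implicits.
Arguments symmetrized_polydisc R n : clear implicits.
Arguments e R n k : clear implicits.
Arguments L R n k l : clear implicits.

(* f and g below are total functions, but only their values on the (open)
   domain matter.  Differentiability is Frechet differentiability over R[i]. *)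
Definition holomorphic_map (R : realType) (U V : normedModType R[i])
    (D : set U) (E : set V) (f : U -> V) : Prop :=
  forall z, D z -> differentiable f z /\ E (f z).

Section InvariantMetrics.
Variables (R : realType) (n : nat) (D : set 'rV[R[i]]_n).
Local Notation C := R[i].
Implicit Types z X : 'rV[C]_n.

Definition caratheodory z X : \bar R :=
  ereal_sup [set (normc ('d f z X))%:E
    | f in [set f : 'rV[C]_n -> C |
            holomorphic_map D (unit_disc R) f /\ f z = 0]].

Definition kobayashi z X : \bar R :=
  ereal_inf [set (normc alpha)%:E
    | alpha in [set alpha : C | exists g : C -> 'rV[C]_n,
                [/\ holomorphic_map (unit_disc R) D g,
                    g 0 = z & alpha *: derive1 g 0 = X]]].

Definition pseudonorm (q : 'rV[C]_n -> R) : Prop :=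
  [/\ forall X, 0 <= q X,
      forall (a : C) X, q (a *: X) = normc a * q X
    & forall X Y, q (X + Y) <= q X + q Y].

(* The largest pseudonorm not exceeding the Kobayashi metric, as the pointwise
   supremum of all of them; see kobayashi_buseman_largest. *)
Definition kobayashi_buseman z X : \bar R :=
  ereal_sup [set (q X)%:E
    | q in [set q : 'rV[C]_n -> R |
            pseudonorm q /\ forall Y, ((q Y)%:E <= kobayashi z Y)%E]].

Lemma kobayashi_buseman_ub z q :
  pseudonorm q -> (forall Y, ((q Y)%:E <= kobayashi z Y)%E) ->
  forall X, ((q X)%:E <= kobayashi_buseman z X)%E.
Proof. by move=> pq qk X; apply: ereal_sup_ubound; exists q. Qed.

Lemma kobayashi_buseman_le z X : (kobayashi_buseman z X <= kobayashi z X)%E.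
Proof. by apply: ge_ereal_sup => _ [q [_ qk] <-]. Qed.

Lemma kobayashi_buseman_largest z :
  (forall X, (kobayashi z X < +oo)%E) ->
  exists p : 'rV[C]_n -> R,
    [/\ forall X, kobayashi_buseman z X = (p X)%:E,
        pseudonorm p,
        forall X, ((p X)%:E <= kobayashi z X)%E
      & forall q, pseudonorm q -> (forall X, ((q X)%:E <= kobayashi z X)%E) ->
          forall X, q X <= p X].
Proof.
move=> kfin; pose good q := pseudonorm q /\
  forall X, ((q X)%:E <= kobayashi z X)%E.
have normc_ge0 (a : C) : 0 <= normc a by case: a => x y; apply: sqrtr_ge0.
have good0 : good (fun=> 0).
  split; first by split=> // *; rewrite ?mulr0 ?addr0.
  by move=> X; apply: le_ereal_inf_tmp => _ [a _ <-]; rewrite lee_fin.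
pose p X := fine (kobayashi_buseman z X).
have pE X : kobayashi_buseman z X = (p X)%:E.
  rewrite /p fineK// ge0_fin_numE ?(kobayashi_buseman_ub good0.1 good0.2)//.
  exact: le_lt_trans (kobayashi_buseman_le z X) (kfin X).
have p_ub q : good q -> forall X, q X <= p X.
  by case=> pq qk X; rewrite -lee_fin -pE kobayashi_buseman_ub.
have p_lub X M : (forall q, good q -> q X <= M) -> p X <= M.
  move=> qM; rewrite -lee_fin -pE; apply: ge_ereal_sup => _ [q gq <-].
  by rewrite lee_fin qM.
have pZ a X : p (a *: X) <= normc a * p X.
  apply: p_lub => q gq; have [_ -> _] := gq.1.
  by rewrite ler_wpM2l// p_ub.
exists p; split=> //.
- split=> [X|a X|X Y]; first exact: (p_ub _ good0).
  + apply/eqP; rewrite eq_le pZ/=; have [->|a0] := eqVneq a 0.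
      by rewrite ComplexField.Normc.normc0 mul0r (p_ub _ good0).
    have na0 : 0 < normc a.
      rewrite lt_neqAle normc_ge0 andbT eq_sym.
      by apply: contra a0 => /eqP/ComplexField.Normc.eq0_normc ->.
    rewrite -ler_pdivlMl// -ComplexField.Normc.normcV.
    by rewrite -[leLHS](congr1 p (scalerK a0 X)) pZ.
  + apply: p_lub => q gq; have [_ _ qD] := gq.1.
    by apply: le_trans (qD X Y) _; rewrite lerD// p_ub.
- by move=> X; rewrite -pE kobayashi_buseman_le.
- by move=> q pq qk; apply: p_ub.
Qed.

End InvariantMetrics.

(* Main.v *)
Require Import Defs.
From HB Require Import structures.
From mathcomp Require Import all_boot all_order all_algebra.
From mathcomp Require Import complex ring lra zify.
From mathcomp Require Import all_classical all_reals all_analysis.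

Set Implicit Arguments.
Unset Strict Implicit.
Unset Printing Implicit Defensive.

Import Order.TTheory GRing.Theory Num.Theory.
Import numFieldNormedType.Exports.
Local Open Scope classical_set_scope.
Local Open Scope ring_scope.

Import ComplexField.Normc.

(** All three parts rest on the functions [costara t], for [t] on the unit
    circle: the quotient of [P'(t)] by [n P(t) - t P'(t)], where
    [P(t) = 1 + S_1 t + ... + S_n t^n] is the generating polynomial of the
    point [S]. If [S = sigma z] then [t P'(t) / P(t)] is the sum of the
    [t z_j / (1 + t z_j)], whose real parts are less than [1/2], and so
    [costara t] maps the symmetrized polydisc into the unit disc. Its
    differential at 0 is [X |-> 1/n sum_j j X_j t^(j-1)], so [rho] is a lower
    bound for the Caratheodory metric; by the Schwarz lemma and the
    subadditivity of [X |-> |f'(0) X|], the latter is at most the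
    Kobayashi-Buseman metric.

    (i) If [n = k m], the disc whose generating polynomials are
    [(1 + z X^k)^m] shows that the Kobayashi metric at [a e_k] is at most
    [|a| k / n] ([kobayashi_e_dvd_le]). As [rho (a e_k + b e_l)] is the sum of
    [|a| k / n] and [|b| l / n] when [k] and [l] differ, all inequalities
    become equalities.

    (ii) Let [g] be a disc with [al g'(0) = a e_1 + b e_n]. For every
    unimodular [t] the function [costara t \o g] is a self-map of the unit
    disc whose first two Taylor coefficients [c_1], [c_2] satisfy
    [|c_2| <= 2 (1 - |c_1|)]. The second coefficient of [g] contributes to
    [c_2] a polynomial of degree at most [n - 1] in [t], whereas [g'(0)]
    contributes a term in [t^n], proportional to [a b]. A signed sum over nodes
    [t] that kills all frequencies up to [n - 1] isolates this term. The nodes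
    are taken close to the [n - 1] points where the maximum defining [rho] is
    attained; if [|al|] were close to [rho], then all [|c_1|] would be close
    to 1 and the isolated term too small ([kobayashi_gap]).

    (iii) Averaging [t^(1-k) costara t] over many points [t] of the circle
    preserves the value [k / n] of the derivative at [e_k]. Where the average
    comes close to modulus 1, all terms have nearly the same unimodular value
    [c]; in the limit [P' = c X^(k-1) (n P - X P')], whose solution
    [(1 + c X^k)^(n/k)] is a polynomial only if [k] divides [n]. By compactness
    of the closed polydisc, the modulus of the average is bounded away from 1,
    and dividing by the bound increases the derivative
    ([rho_lt_caratheodory_e]).

    The complex analysis needed is the Schwarz lemma and its second-order
    version, for functions that are only assumed complex differentiable. Both
    follow from one fact: if [F] is differentiable in the punctured disc, the
    mean of [F] over the points [r w^j], [w] a primitive [2^N]-th root of unity,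
    becomes independent of [r] as [N] tends to infinity
    ([circle_mean_radius]). This is Goursat's theorem for [F z / z] on an
    annulus, proved with trapezoidal sums along dyadic grids in place of
    contour integrals ([goursat_square]). *)

(** * Moduli of complex numbers *)

Section Modulus.
Variable R : realType.
Local Notation C := R[i].
Implicit Types x y z : C.

Lemma normc_ge0 z : 0 <= normc z.
Proof. by case: z => a b; apply: sqrtr_ge0. Qed.

Lemma normr_normc z : `|z| = ((normc z)%:C)%C. Proof. by []. Qed.

Lemma normcD_le x y : normc (x + y) <= normc x + normc y.
Proof. exact: le_normcD. Qed.

Lemma normcNE z : normc (- z) = normc z.
Proof. exact: normcN. Qed.

Lemma normcC x y : normc (x - y) = normc (y - x).
Proof. by rewrite -normcNE opprB. Qed.

Lemma normcB_le x y : normc (x - y) <= normc x + normc y.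
Proof. by rewrite -(normcNE y) normcD_le. Qed.

Lemma normc_sum (I : Type) (r : seq I) (P : pred I) (F : I -> C) :
  normc (\sum_(i <- r | P i) F i) <= \sum_(i <- r | P i) normc (F i).
Proof.
elim/big_rec2: _ => [|i y x _ le_xy]; first by rewrite normc0.
exact: le_trans (normcD_le _ _) (lerD _ le_xy).
Qed.

Lemma normcX z n : normc (z ^+ n) = normc z ^+ n.
Proof. by elim: n => [|n IHn]; rewrite ?expr0 ?normc1// !exprS normcM IHn. Qed.

Lemma normc_real (a : R) : normc (a%:C)%C = `|a|.
Proof. by rewrite /= expr0n/= addr0 sqrtr_sqr. Qed.

Lemma normc_nat n : normc (n%:R : C) = n%:R.
Proof.
by rewrite -(rmorph_nat (real_complex R)) normc_real ger0_norm.
Qed.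

Lemma normc_eq0 z : (normc z == 0) = (z == 0).
Proof. by apply/eqP/eqP => [/eq0_normc//|->]; rewrite normc0. Qed.

Lemma normc_gt0 z : (0 < normc z) = (z != 0).
Proof. by rewrite lt_def normc_ge0 andbT normc_eq0. Qed.

Lemma ltr_normc z (a : R) : (`|z| < (a%:C)%C) = (normc z < a).
Proof. by rewrite normr_normc ltcR. Qed.

Lemma ball_normc z y (a : R) : ball z (a%:C)%C y <-> normc (y - z) < a.
Proof.
by rewrite -(@ball_normE R[i] R[i]) /ball_/= ltr_normc normcC.
Qed.

Lemma nbhs_normcP (z : C) (A : set C) :
  nbhs z A <-> exists2 d : R, 0 < d & forall y, normc (y - z) < d -> A y.
Proof.
split=> [/(@nbhs_ballP R[i] R[i] z A)[e /= e0 zA]|[d d0 dA]].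
  have [d eE] : exists d : R, e = (d%:C)%C.
    by apply/complex_realP; exact: gtr0_real.
  exists d; first by move: e0; rewrite eE ltcR.
  move=> y yd; apply: zA; by rewrite eE ball_normc.
apply: (@nbhs_ballP R[i] R[i] z A).2; exists (d%:C)%C; first by rewrite /= ltcR.
by move=> y; rewrite ball_normc; exact: dA.
Qed.

(** Goursat's bisection compares error terms with the side of a square, hence
    this form of the first-order expansion, with real bounds. *)
Lemma differentiable_normc (f : C -> C) (z : C) : differentiable f z ->
  exists c, forall e : R, 0 < e -> exists2 d : R, 0 < d &
    forall y, normc (y - z) < d ->
      normc (f y - f z - c * (y - z)) <= e * normc (y - z).
Proof.
move=> df; exists ('d f z 1) => e e0.
have /eqaddoP/(_ (e%:C)%C) := diff_locally df.
rewrite ltcR => /(_ e0) /nbhs_normcP[d d0 dP]; exists d => // y yd.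
have /= := dP (y - z); rewrite subr0 => /(_ yd).
rewrite /= !fctE/= addrNK.
have -> : 'd f z (y - z) = 'd f z 1 * (y - z).
  by rewrite -[y - z in LHS]mulr1 [LHS]linearZ/= mulrC.
rewrite opprD addrA !normr_normc -(rmorphM (real_complex R)) lecR.
by [].
Qed.

(** Bisection only needs the corners of the nested intervals. *)
Lemma nested_dyadic (a : nat -> R) :
  (forall p, a p <= a p.+1 <= a p + 2^-1 ^+ p.+1) ->
  exists l, forall p, [/\ a 0%N <= a p, a p <= l, l <= a p + 2^-1 ^+ p
    & a p + 2^-1 ^+ p <= a 0%N + 1].
Proof.
move=> ha.
have a_le p k : a p <= a (p + k)%N.
  elim: k => [|k IH]; first by rewrite addn0.
  by rewrite addnS (le_trans IH)//; have /andP[] := ha (p + k)%N.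
have b_le p k : a (p + k)%N + 2^-1 ^+ (p + k) <= a p + 2^-1 ^+ p.
  elim: k => [|k IH]; first by rewrite addn0.
  apply: le_trans IH; have /andP[_] := ha (p + k)%N.
  rewrite addnS; move: (2^-1 ^+ (p + k).+1) (exprS (2^-1 : R) (p + k)) => u ->.
  by move: (2^-1 ^+ (p + k)) => {}u ?; lra.
have pow_ge0 p : 0 <= 2^-1 ^+ p :> R by rewrite exprn_ge0.
have ab p q : a q <= a p + 2^-1 ^+ p.
  apply: (le_trans (a_le q p)); rewrite addnC.
  by apply: le_trans (b_le p q); rewrite lerDl.
have ubA : has_ubound (range a) by exists (a 0%N + 2^-1 ^+ 0) => _ [q _ <-].
exists (sup (range a)) => p; split.
- by have := a_le 0%N p; rewrite add0n.
- by apply: ub_le_sup => //; exists p.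
- by apply: ge_sup; [exists (a 0%N), 0%N | move=> _ [q _ <-]].
- by have := b_le 0%N p; rewrite add0n expr0.
Qed.

End Modulus.

(** * Goursat's theorem by trapezoidal sums *)

Section GridSums.
Variable R : realType.
Local Notation C := R[i].
Implicit Types (f g : C -> C) (P : nat -> nat -> C).

(** Twice the trapezoidal approximation of the integral of [f] from [p] to
    [q]. *)
Definition edge f (p q : C) : C := (f p + f q) * (q - p).

Definition cell f P (i j : nat) : C :=
  edge f (P i j) (P i.+1 j) + edge f (P i.+1 j) (P i.+1 j.+1)
  + edge f (P i.+1 j.+1) (P i j.+1) + edge f (P i j.+1) (P i j).

Definition grid_sum f P (M : nat) : C := \sum_(i < M) \sum_(j < M) cell f P i j.

Lemma edgeC f p q : edge f q p = - edge f p q.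
Proof. by rewrite /edge; ring. Qed.

(** The trapezoidal rule is exact on affine functions, whose integral over a
    closed polygon vanishes. *)
Lemma grid_sum_affine f P M (a c : C) :
  grid_sum (fun z => f z - (a + c * z)) P M = grid_sum f P M.
Proof.
by apply: eq_bigr => i _; apply: eq_bigr => j _; rewrite /cell /edge; ring.
Qed.

(** Inner edges are run through twice, in opposite directions. *)
Lemma grid_sum_boundary f P M : grid_sum f P M =
  \sum_(i < M) (edge f (P i 0) (P i.+1 0) - edge f (P i M) (P i.+1 M))
  + \sum_(j < M) (edge f (P M j) (P M j.+1) - edge f (P 0 j) (P 0 j.+1)).
Proof.
pose H i j := edge f (P i j) (P i.+1 j).
pose V i j := edge f (P i j) (P i j.+1).
have cellE i j : cell f P i j = (H i j - H i j.+1) + (V i.+1 j - V i j).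
  by rewrite /cell (edgeC _ (P i j.+1)) (edgeC _ (P i j)) /H /V; ring.
rewrite /grid_sum.
under eq_bigr do under eq_bigr do rewrite cellE.
under eq_bigr do rewrite big_split/=.
rewrite big_split/=; congr (_ + _).
  apply: eq_bigr => i _.
  rewrite -(big_mkord xpredT (fun j => H i j - H i j.+1)).
  under eq_bigr do rewrite -opprB.
  by rewrite sumrN telescope_sumr// opprB.
rewrite exchange_big/=; apply: eq_bigr => j _.
rewrite -(big_mkord xpredT (fun i => V i.+1 j - V i j)).
by rewrite telescope_sumr.
Qed.

End GridSums.

Section Goursat.
Variable R : realType.
Local Notation C := R[i].
Implicit Types (f g : C -> C) (P : nat -> nat -> C).

(** Only the [4 M] boundary edges matter, so the bound is linear in [M]. *)
Lemma grid_sum_le f P M (m d : R) :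
  (forall i j, (i <= M)%N -> (j <= M)%N -> normc (f (P i j)) <= m) ->
  (forall i j, (i < M)%N -> (j <= M)%N -> normc (P i.+1 j - P i j) <= d) ->
  (forall i j, (i <= M)%N -> (j < M)%N -> normc (P i j.+1 - P i j) <= d) ->
  normc (grid_sum f P M) <= 8 * M%:R * m * d.
Proof.
move=> fm hd vd.
have m0 : 0 <= m by apply: le_trans (fm 0 0 _ _); rewrite ?normc_ge0.
have edge_le p q : normc (f p) <= m -> normc (f q) <= m -> normc (q - p) <= d ->
    normc (edge f p q) <= 2 * m * d.
  move=> pm qm pq; rewrite /edge normcM ler_pM ?normc_ge0//.
  by apply: (le_trans (normcD_le _ _)); lra.
have two_edges x y : normc x <= 2 * m * d -> normc y <= 2 * m * d ->
    normc (x - y) <= 4 * m * d.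
  by move=> xm ym; apply: (le_trans (normcB_le _ _)); lra.
have sum_le (F : 'I_M -> C) : (forall i, normc (F i) <= 4 * m * d) ->
    normc (\sum_(i < M) F i) <= 4 * m * d * M%:R.
  move=> Fm; apply: (le_trans (normc_sum _ _ _)).
  apply: (le_trans (ler_sum _ (fun i _ => Fm i))).
  by rewrite sumr_const card_ord mulr_natr.
rewrite grid_sum_boundary.
apply: (@le_trans _ _ (4 * m * d * M%:R + 4 * m * d * M%:R)); last by lra.
apply: (le_trans (normcD_le _ _)); apply: lerD; apply: sum_le => i;
  by apply: two_edges; apply: edge_le; rewrite ?fm ?hd ?vd// ltnW.
Qed.

Lemma grid_sum_quarter f P M : grid_sum f P (M + M) =
  \sum_(a < 2) \sum_(b < 2) grid_sum f (fun i j => P (a * M + i)%N (b * M + j)%N) M.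
Proof.
rewrite /grid_sum big_split_ord/= !big_ord_recr !big_ord0/= !add0r.
under eq_bigr do rewrite big_split_ord/=.
under [X in _ + X = _]eq_bigr do rewrite big_split_ord/=.
rewrite !big_split/=; congr (_ + _ + (_ + _)); apply: eq_bigr => i _;
  apply: eq_bigr => j _; rewrite /cell ?mul0n ?mul1n ?add0n ?addnS//.
Qed.

Variables (f : C -> C) (psi : R -> R -> C).

Definition dyadic_node (s t d : R) (N i j : nat) : C :=
  psi (s + d * (i%:R / 2 ^+ N)) (t + d * (j%:R / 2 ^+ N)).

Definition dyadic_sum (N : nat) (s t d : R) : C :=
  grid_sum f (dyadic_node s t d N) (2 ^ N).

Lemma dyadic_sum_quarter N s t d : dyadic_sum N.+1 s t d =
  \sum_(a < 2) \sum_(b < 2)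
    dyadic_sum N (s + a%:R * (d / 2)) (t + b%:R * (d / 2)) (d / 2).
Proof.
rewrite /dyadic_sum expnS mul2n -addnn grid_sum_quarter.
apply: eq_bigr => a _; apply: eq_bigr => b _; congr (grid_sum f _ _).
apply/funext => i; apply/funext => j; rewrite /dyadic_node.
have E (u : R) (c k : nat) : u + d * ((c * 2 ^ N + k)%:R / 2 ^+ N.+1) =
    u + c%:R * (d / 2) + d / 2 * (k%:R / 2 ^+ N).
  have p0 : (2 : R) ^+ N != 0 by rewrite expf_neq0.
  by rewrite exprS natrD natrM natrX; field.
by rewrite !E.
Qed.

(** The bisection step. The sums at different levels [N] are not comparable, so
    a square is bad if its sums are large for arbitrarily large [N]; if all four
    quarters were good from some level on, then so would be the square. *)
Lemma quarter_bad (c s t d : R) :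
  (forall N0, exists2 N, (N0 <= N)%N & c * d ^+ 2 < normc (dyadic_sum N s t d)) ->
  exists a b : 'I_2, forall N0, exists2 N, (N0 <= N)%N & c * (d / 2) ^+ 2
    < normc (dyadic_sum N (s + a%:R * (d / 2)) (t + b%:R * (d / 2)) (d / 2)).
Proof.
move=> bad; apply: contrapT => good.
have {}good (a b : 'I_2) : exists N0, forall N, (N0 <= N)%N ->
   normc (dyadic_sum N (s + a%:R * (d / 2)) (t + b%:R * (d / 2)) (d / 2))
     <= c * (d / 2) ^+ 2.
  apply: contrapT => bad_ab; apply: good; exists a, b => N0.
  apply: contrapT => le_ab; apply: bad_ab; exists N0 => N leN.
  by rewrite leNgt; apply/negP => lt_ab; apply: le_ab; exists N.
have [N0 N0P] := choice (fun ab : 'I_2 * 'I_2 => good ab.1 ab.2).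
have [[//|N] leN] := bad (\max_ab N0 ab).+1.
apply/negP; rewrite -leNgt dyadic_sum_quarter.
have -> : c * d ^+ 2 = \sum_(a < 2) \sum_(b < 2) c * (d / 2) ^+ 2.
  by rewrite !sumr_const !card_ord; field.
apply: (le_trans (normc_sum _ _ _)); apply: ler_sum => a _.
apply: (le_trans (normc_sum _ _ _)); apply: ler_sum => b _.
apply: (N0P (a, b)); apply: (leq_trans _ (ltnSE leN)).
exact: (leq_bigmax (a, b)).
Qed.

Variable K : R.
Hypothesis psi_lip : forall s t s' t', 0 <= s <= 1 -> 0 <= t <= 1 ->
  0 <= s' <= 1 -> 0 <= t' <= 1 ->
  normc (psi s t - psi s' t') <= K * (`|s - s'| + `|t - t'|).

(** Subtracting the tangent map of [f] at [psi s0 t0] leaves values [o(d)] on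
    edges of total length [O(d)], uniformly in the level [N]. *)
Lemma dyadic_sum_small s0 t0 (e : R) : 0 <= K -> 0 < e ->
    0 <= s0 <= 1 -> 0 <= t0 <= 1 -> differentiable f (psi s0 t0) ->
  exists2 r : R, 0 < r & forall N s t d, 0 < d < r ->
    0 <= s -> s <= s0 <= s + d -> s + d <= 1 ->
    0 <= t -> t <= t0 <= t + d -> t + d <= 1 ->
    normc (dyadic_sum N s t d) <= e * d ^+ 2.
Proof.
move=> K0 e0 s01 t01 /differentiable_normc[c].
have K1 : 0 < 1 + 16 * K ^+ 2 by rewrite ltr_wpDr// mulr_ge0// sqr_ge0.
pose e' := e / (1 + 16 * K ^+ 2).
have e'0 : 0 < e' by rewrite divr_gt0.
case/(_ e' e'0) => r r0 small.
exists (r / (2 * K + 1)); first by rewrite divr_gt0//; lra.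
move=> N s t d /andP[d0 dr] s_ge0 /andP[ss0 s0s] sd t_ge0 /andP[tt0 t0t] td.
have dyad i : (i <= 2 ^ N)%N -> 0 <= (i%:R / 2 ^+ N : R) <= 1.
  move=> leiN; rewrite divr_ge0 ?exprn_ge0//= ler_pdivrMr ?exprn_gt0// mul1r.
  by rewrite -natrX ler_nat.
have inI (u : R) i : (i <= 2 ^ N)%N -> 0 <= u -> u + d <= 1 ->
    [/\ 0 <= u + d * (i%:R / 2 ^+ N) <= 1, u <= u + d * (i%:R / 2 ^+ N)
      & u + d * (i%:R / 2 ^+ N) <= u + d].
  move=> /dyad; move: (_ / _) => x /andP[x0 x1] u0 ud.
  have dx0 : 0 <= d * x by rewrite mulr_ge0// ltW.
  have dx1 : d * x <= d by rewrite ler_piMr// ltW.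
  by split; [apply/andP; split|..]; lra.
rewrite /dyadic_sum -(grid_sum_affine _ _ _ (f (psi s0 t0) - c * psi s0 t0) c).
set P := dyadic_node _ _ _ _.
have near0 i j : (i <= 2 ^ N)%N -> (j <= 2 ^ N)%N ->
    normc (P i j - psi s0 t0) <= 2 * K * d.
  move=> iN jN; have [si s1 s2] := inI s i iN s_ge0 sd.
  have [tj t1 t2] := inI t j jN t_ge0 td.
  apply: (le_trans (psi_lip si tj s01 t01)).
  rewrite [2 * K]mulrC -mulrA ler_wpM2l// [2 * d]mulr_natl mulr2n lerD//;
    by rewrite ler_norml; apply/andP; split; lra.
have val_le i j : (i <= 2 ^ N)%N -> (j <= 2 ^ N)%N ->
    normc (f (P i j) - (f (psi s0 t0) - c * psi s0 t0 + c * P i j))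
      <= e' * (2 * K * d).
  move=> iN jN; have nij := near0 i j iN jN.
  have -> : f (P i j) - (f (psi s0 t0) - c * psi s0 t0 + c * P i j) =
    f (P i j) - f (psi s0 t0) - c * (P i j - psi s0 t0) by ring.
  apply: (le_trans (small _ _)); last by rewrite ler_wpM2l// ltW.
  apply: (le_lt_trans nij); move: dr; rewrite ltr_pdivlMr; last by lra.
  by apply: le_lt_trans; rewrite mulrC ler_wpM2l ?ltW//; lra.
have M0 : 0 < 2 ^+ N :> R by rewrite exprn_gt0.
have diffS (i : nat) : i.+1%:R / 2 ^+ N - i%:R / 2 ^+ N = (2 ^+ N)^-1 :> R.
  by rewrite -mulrBl -natr1 addrAC subrr add0r mul1r.
have stepE (u : R) (i : nat) :
   `|u + d * (i.+1%:R / 2 ^+ N) - (u + d * (i%:R / 2 ^+ N))| = d * (2 ^+ N)^-1.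
  have -> : u + d * (i.+1%:R / 2 ^+ N) - (u + d * (i%:R / 2 ^+ N)) =
     d * (i.+1%:R / 2 ^+ N - i%:R / 2 ^+ N) by ring.
  by rewrite diffS ger0_norm// mulr_ge0 ?invr_ge0// ltW.
have -> : e * d ^+ 2 = (1 + 16 * K ^+ 2) * (e' * d ^+ 2).
  by rewrite /e'; field; rewrite gt_eqF.
apply: (@le_trans _ _ (16 * K ^+ 2 * (e' * d ^+ 2))); last first.
  by rewrite ler_wpM2r ?lerDr// mulr_ge0 ?sqr_ge0// ltW.
have -> : 16 * K ^+ 2 * (e' * d ^+ 2) =
    8 * (2 ^ N)%:R * (e' * (2 * K * d)) * (K * (d * (2 ^+ N)^-1)).
  by rewrite natrX; field; rewrite gt_eqF.
apply: grid_sum_le => i j iN jN; first exact: val_le.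
- have [si _ _] := inI s i (ltnW iN) s_ge0 sd.
  have [si' _ _] := inI s i.+1 iN s_ge0 sd.
  have [tj _ _] := inI t j jN t_ge0 td.
  by apply: (le_trans (psi_lip _ _ _ _)) => //; rewrite stepE subrr normr0 addr0.
- have [si _ _] := inI s i iN s_ge0 sd.
  have [tj' _ _] := inI t j.+1 jN t_ge0 td.
  have [tj _ _] := inI t j (ltnW jN) t_ge0 td.
  by apply: (le_trans (psi_lip _ _ _ _)) => //; rewrite stepE subrr normr0 add0r.
Qed.

(** Otherwise repeated quartering produces bad squares shrinking to a point,
    against differentiability of [f] there. *)
Theorem goursat_square (e : R) : 0 <= K -> 0 < e ->
    (forall s t, 0 <= s <= 1 -> 0 <= t <= 1 -> differentiable f (psi s t)) ->
  exists N0, forall N, (N0 <= N)%N -> normc (dyadic_sum N 0 0 1) <= e.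
Proof.
move=> K0 e0 df; apply: contrapT => notgood.
pose bad p (x : R * R) := forall N0, exists2 N, (N0 <= N)%N &
  e * (2^-1 ^+ p) ^+ 2 < normc (dyadic_sum N x.1 x.2 (2^-1 ^+ p)).
have bad0 : bad 0%N (0, 0).
  move=> N0; apply: contrapT => noN; apply: notgood; exists N0 => N leN.
  rewrite leNgt; apply/negP => ltN; apply: noN; exists N => //=.
  by rewrite expr0 expr1n mulr1.
have step (px : nat * (R * R)) : exists y : R * R, bad px.1 px.2 ->
    [/\ bad px.1.+1 y, px.2.1 <= y.1 <= px.2.1 + 2^-1 ^+ px.1.+1
      & px.2.2 <= y.2 <= px.2.2 + 2^-1 ^+ px.1.+1].
  case: px => p [s t] /=; have [bp|nbp] := pselect (bad p (s, t)); last first.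
    by exists (s, t).
  have [a [b abP]] := quarter_bad bp.
  have E : 2^-1 ^+ p / 2 = 2^-1 ^+ p.+1 :> R by rewrite exprSr.
  rewrite E /= in abP.
  exists (s + a%:R * 2^-1 ^+ p.+1, t + b%:R * 2^-1 ^+ p.+1) => _; split=> //=.
    have := ltn_ord a; case: (nat_of_ord a) => [|[|//]] _;
      by rewrite ?mul0r ?mul1r ?addr0 lexx ?lerDl ?lerDr ?exprn_ge0.
  have := ltn_ord b; case: (nat_of_ord b) => [|[|//]] _;
      by rewrite ?mul0r ?mul1r ?addr0 lexx ?lerDl ?lerDr ?exprn_ge0.
have [F FP] := choice step.
pose x := fix x p := if p is q.+1 then F (q, x q) else (0 : R, 0 : R).
have badx p : bad p (x p).
  by elim: p => [|p IH] //; have [] := FP (p, x p) IH.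
have xP p := FP (p, x p) (badx p).
have [s0 s0P] : exists l, forall p, [/\ 0 <= (x p).1, (x p).1 <= l,
    l <= (x p).1 + 2^-1 ^+ p & (x p).1 + 2^-1 ^+ p <= 0 + 1].
  by apply: (@nested_dyadic _ (fun p => (x p).1)) => p; have [] := xP p.
have [t0 t0P] : exists l, forall p, [/\ 0 <= (x p).2, (x p).2 <= l,
    l <= (x p).2 + 2^-1 ^+ p & (x p).2 + 2^-1 ^+ p <= 0 + 1].
  by apply: (@nested_dyadic _ (fun p => (x p).2)) => p; have [] := xP p.
have s01 : 0 <= s0 <= 1.
  by have [] := s0P 0%N; rewrite expr0 add0r => _ -> /= /le_trans; apply.
have t01 : 0 <= t0 <= 1.
  by have [] := t0P 0%N; rewrite expr0 add0r => _ -> /= /le_trans; apply.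
have [r r0 rP] := dyadic_sum_small K0 e0 s01 t01 (df _ _ s01 t01).
have [p pr] : exists p, 2^-1 ^+ p < r.
  have /cvgrPdist_lt/(_ _ r0)[p _ pP] : (2^-1 : R) ^+ n @[n --> \oo] --> (0 : R).
    by apply: cvg_expr; rewrite ger0_norm ?invf_lt1// ltr1n.
  exists p; have := pP p (leqnn p); rewrite /= sub0r normrN ger0_norm//.
have [N _] := badx p 0%N; apply/negP; rewrite -leNgt.
have [? ? ?] := s0P p; have [? ? ?] := t0P p; rewrite !add0r => ? ?.
by apply: rP => //; rewrite ?exprn_gt0//; apply/andP.
Qed.

End Goursat.

(** * Means over roots of unity *)

Section ComplexLimits.
Variable R : realType.
Local Notation C := R[i].

Lemma cvg_normcP (T : Type) (F : set_system T) {FF : Filter F} (u : T -> C) (l : C) :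
  u x @[x --> F] --> l <->
  forall e : R, 0 < e -> \forall x \near F, normc (u x - l) <= e.
Proof.
split=> [ul e e0|ul].
  have : nbhs l [set y | normc (y - l) <= e].
    by apply/nbhs_normcP; exists e => // y /ltW.
  by move/ul.
move=> A /nbhs_normcP[d d0 dA]; rewrite /nbhs/=.
have d20 : 0 < d / 2 by rewrite divr_gt0.
by apply: filterS (ul _ d20) => x /= xd; apply: dA; lra.
Qed.

Lemma dnbhs0_normcP (A : set C) :
  0^' A <-> exists2 d : R, 0 < d & forall y, y != 0 -> normc y < d -> A y.
Proof.
rewrite /dnbhs /within; split.
  case/nbhs_normcP => d d0 dA; exists d => // y y0 yd.
  by apply: dA; rewrite ?subr0.
case=> d d0 dA; apply/nbhs_normcP; exists d => // y; rewrite subr0 => yd y0.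
exact: dA.
Qed.

Lemma cvg_normc_le (T : Type) (F : set_system T) {FF : ProperFilter F}
    (u : T -> C) (l : C) (b : R) : u x @[x --> F] --> l ->
  (forall e, 0 < e -> \forall x \near F, normc (u x) <= b + e) -> normc l <= b.
Proof.
move=> /cvg_normcP ul ub; apply/ler_addgt0Pr => e e0.
have e20 : 0 < e / 2 by rewrite divr_gt0.
have [x [ux1 ux2]] := @filter_ex _ F FF _ (filterI (ul _ e20) (ub _ e20)).
have -> : l = u x - (u x - l) by ring.
by apply: (le_trans (normcB_le _ _)); lra.
Qed.

End ComplexLimits.

Section UnitCircle.
Variable R : realType.
Local Notation C := R[i].

(** The exponential [exp (2 i pi t)]. *)
Definition turn (t : R) : C := (cos (t * (pi *+ 2)) +i* sin (t * (pi *+ 2)))%C.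

Lemma turnD s t : turn (s + t) = turn s * turn t.
Proof.
rewrite /turn mulrDl cosD sinD; simpc.
by apply/eqP; rewrite eq_complex/= eqxx/= addrC mulrC [X in _ + X]mulrC; apply/eqP; ring.
Qed.

Lemma turn0 : turn 0 = 1.
Proof. by rewrite /turn mul0r cos0 sin0. Qed.

Lemma turn1 : turn 1 = 1.
Proof. by rewrite /turn mul1r cos2pi sin2pi. Qed.

Lemma turn_half : turn 2^-1 = -1.
Proof.
have -> : turn 2^-1 = (cos pi +i* sin pi)%C.
  by rewrite /turn; have -> : 2^-1 * (pi *+ 2) = pi :> R by field.
by rewrite cospi sinpi; apply/eqP; rewrite eq_complex/= oppr0 !eqxx.
Qed.

Lemma normc_turn t : normc (turn t) = 1.
Proof. by rewrite /turn /normc cos2Dsin2 sqrtr1. Qed.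

Lemma turn_neq0 t : turn t != 0.
Proof. by rewrite -normc_gt0 normc_turn. Qed.

Lemma turnX t n : turn t ^+ n = turn (n%:R * t).
Proof.
elim: n => [|n IH]; first by rewrite mul0r turn0.
by rewrite exprS IH -turnD -(natr1 n) mulrDl mul1r addrC.
Qed.

Lemma turn_neq1 t : 0 < t < 1 -> turn t != 1.
Proof.
move=> /andP[t0 t1]; apply/eqP => tE.
(* Half of the turn lies strictly inside the upper half-circle, yet its sine
   vanishes if the turn is complete. *)
have pi0 := pi_gt0 R.
have : 0 < sin (t * pi).
  by apply: sin_gt0_pi; rewrite mulr_gt0//= gtr_pMl.
have : cos (t * (pi *+ 2)) = 1 by rewrite -[LHS]/(complex.Re (turn t)) tE.
have -> : t * (pi *+ 2) = t * pi *+ 2 by rewrite mulrnAr.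
rewrite cos_mulr2n cos2sin2 => cE s0.
have : sin (t * pi) ^+ 2 = 0 by move: cE; rewrite mulr2n; lra.
by move/eqP; rewrite sqrf_eq0 gt_eqF.
Qed.

Lemma lipschitz_of_derive (f df : R -> R) (x y : R) :
  (forall z : R, is_derive z (1 : R) f (df z)) -> (forall z, `|df z| <= 1) ->
  `|f x - f y| <= `|x - y|.
Proof.
move=> fdf df1; wlog xy : x y / x <= y.
  by move=> H; have [/H//|/ltW/H] := leP x y; rewrite distrC [`|x - y|]distrC.
have cf : {within `[x, y], continuous f}.
  apply: continuous_subspaceT => z.
  by apply: differentiable_continuous; apply/derivable1_diffP; case: (fdf z).
have [c _ E] := MVT_segment xy (fun z _ => fdf z) cf.
by rewrite distrC E normrM [`|x - y|]distrC ler_piMl.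
Qed.

Lemma turn_lipschitz s t : normc (turn s - turn t) <= 4 * pi * `|s - t|.
Proof.
have pi0 := pi_ge0 R.
have normc_le (a b : R) : normc (a +i* b)%C <= `|a| + `|b|.
  have -> : (a +i* b)%C = (a%:C)%C + (b%:C)%C * 'i%C by simpc.
  apply: (le_trans (normcD_le _ _)); rewrite normcM !normc_real.
  by rewrite /normc expr0n expr1n add0r sqrtr1 mulr1.
have -> : turn s - turn t = Complex (cos (s * (pi *+ 2)) - cos (t * (pi *+ 2)))
     (sin (s * (pi *+ 2)) - sin (t * (pi *+ 2))) by rewrite /turn; simpc.
have E : `|s * (pi *+ 2) - t * (pi *+ 2)| = 2 * pi * `|s - t|.
  rewrite -mulrBl normrM mulrC; congr (_ * _).
  by rewrite ger0_norm; [ring | rewrite mulrn_wge0].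
apply: (le_trans (normc_le _ _)).
have c1 : `|cos (s * (pi *+ 2)) - cos (t * (pi *+ 2))| <= 2 * pi * `|s - t|.
  rewrite -E; apply: (@lipschitz_of_derive _ (fun x => - sin x)) => x.
  by rewrite normrN sin_max.
have c2 : `|sin (s * (pi *+ 2)) - sin (t * (pi *+ 2))| <= 2 * pi * `|s - t|.
  rewrite -E; apply: (@lipschitz_of_derive _ cos) => x.
  exact: cos_max.
by lra.
Qed.

Lemma normc_sub1X (z : C) k : normc z <= 1 -> normc (z ^+ k - 1) <= k%:R * normc (z - 1).
Proof.
move=> z1; rewrite subrX1 normcM mulrC ler_wpM2r ?normc_ge0//.
apply: (le_trans (normc_sum _ _ _)).
have -> : k%:R = \sum_(i < k) (1 : R) by rewrite sumr_const card_ord.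
by apply: ler_sum => i _; rewrite normcX exprn_ile1 ?normc_ge0.
Qed.

Definition dyadic_root (N : nat) : C := turn (2 ^+ N)^-1.

Lemma dyadic_rootX N j : dyadic_root N ^+ j = turn (j%:R / 2 ^+ N).
Proof. exact: turnX. Qed.

Lemma dyadic_rootX1 N : dyadic_root N ^+ (2 ^ N) = 1.
Proof. by rewrite dyadic_rootX natrX divff ?turn1// expf_neq0. Qed.

Lemma normc_dyadic_root N : normc (dyadic_root N) = 1.
Proof. exact: normc_turn. Qed.

(** The square of the root has [-1] among its powers, which keeps it away
    from [1]. *)
Lemma dyadic_root_gap N : (2 <= N)%N ->
  8 <= 2 ^+ N * normc (dyadic_root N - (dyadic_root N)^-1).
Proof.
case: N => [|[|N]]// _; set w := dyadic_root _.
have w0 : w != 0 by apply: turn_neq0.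
have -> : normc (w - w^-1) = normc (w ^+ 2 - 1).
  have -> : w ^+ 2 - 1 = w * (w - w^-1) by rewrite mulrBr divff// expr2.
  by rewrite normcM normc_turn mul1r.
have := @normc_sub1X (w ^+ 2) (2 ^ N).
rewrite normcX normc_turn expr1n lexx => /(_ isT).
have -> : (w ^+ 2) ^+ (2 ^ N) = -1.
  rewrite -exprM -expnS dyadic_rootX -turn_half; congr turn.
  by rewrite natrX [in X in _ / X]exprS invfM mulrCA divff ?mulr1// expf_neq0.
have -> : normc (-1 - 1 : C) = 2.
  by rewrite -opprD normcNE -[1 + 1]/(2%:R) normc_nat.
by rewrite natrX !exprS; move: (_ ^+ _) (normc _) => u v; lra.
Qed.

End UnitCircle.

Section CircleMeans.
Variable R : realType.
Local Notation C := R[i].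
Local Notation D := (unit_disc R).
Implicit Types (F h : C -> C) (r : R).

Definition circle_mean F (N : nat) r : C :=
  (2 ^+ N)^-1 * \sum_(j < 2 ^ N) F ((r%:C)%C * dyadic_root R N ^+ j).

Lemma circle_meanD F G N r :
  circle_mean (fun z => F z + G z) N r = circle_mean F N r + circle_mean G N r.
Proof. by rewrite /circle_mean big_split mulrDr. Qed.

Lemma circle_meanZ (c : C) F N r :
  circle_mean (fun z => c * F z) N r = c * circle_mean F N r.
Proof. by rewrite /circle_mean -mulr_sumr mulrCA. Qed.

Lemma circle_mean_sum (I : finType) (F : I -> C -> C) N r :
  circle_mean (fun z => \sum_i F i z) N r = \sum_i circle_mean (F i) N r.
Proof.
by rewrite /circle_mean exchange_big/= mulr_sumr.
Qed.

Lemma normc_circle_mean F N r (b : R) : 0 <= r ->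
    (forall z, normc z = r -> normc (F z) <= b) -> normc (circle_mean F N r) <= b.
Proof.
move=> r0 Fb; have M0 : 0 < 2 ^+ N :> R by rewrite exprn_gt0.
rewrite /circle_mean normcM normcV normcX (normc_nat R 2).
rewrite ler_pdivrMl//; apply: (le_trans (normc_sum _ _ _)).
have -> : 2 ^+ N * b = \sum_(j < 2 ^ N) b.
  by rewrite sumr_const card_ord -[b *+ _]mulr_natl natrX.
apply: ler_sum => j _; apply: Fb.
by rewrite normcM normc_real normcX normc_dyadic_root expr1n mulr1 ger0_norm.
Qed.

(** Summation by parts: around a circle, the trapezoidal sums of [F z / z] are
    means of [F] up to a factor that does not depend on the radius. *)
Lemma circle_edge_sum F N r : r != 0 ->
  let p j := (r%:C)%C * dyadic_root R N ^+ j in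
  \sum_(j < 2 ^ N) edge (fun z => F z / z) (p j) (p j.+1) =
  (dyadic_root R N - (dyadic_root R N)^-1) * (2 ^+ N * circle_mean F N r).
Proof.
move=> r0 p; set w := dyadic_root R N.
have w0 : w != 0 by apply: turn_neq0.
have p0 j : p j != 0.
  rewrite mulf_neq0 ?expf_neq0//; by apply: contra r0 => /eqP/complexI ->.
have pS j : p j.+1 = w * p j by rewrite /p exprS mulrCA.
have M0 : (2 : C) ^+ N != 0 by rewrite expf_neq0.
rewrite /circle_mean mulVKf//.
pose G j := F (p j) / p j * (p j - w^-1 * p j).
have edgeE j : edge (fun z => F z / z) (p j) (p j.+1) =
    (w - w^-1) * F (p j) + (G j.+1 - G j).
  by rewrite /edge /G pS; field; rewrite p0 w0.
rewrite (eq_bigr _ (fun (i : 'I__) _ => edgeE i)) big_split/=.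
rewrite -mulr_sumr -[X in _ + X](big_mkord xpredT (fun j => G j.+1 - G j)).
rewrite telescope_sumr//.
have -> : G (2 ^ N)%N = G 0%N by rewrite /G /p dyadic_rootX1 expr0.
by rewrite subrr addr0.
Qed.

(** Circle means of a function holomorphic in the punctured disc do not depend
    on the radius in the limit: Goursat for [F z / z] on an annulus, the
    two radial edges cancelling. *)
Lemma circle_mean_radius F r1 r2 : 0 < r1 < 1 -> 0 < r2 < 1 ->
    (forall z, D z -> z != 0 -> differentiable F z) ->
  circle_mean F N r2 - circle_mean F N r1 @[N --> \oo] --> (0 : C).
Proof.
move=> /andP[r1_gt0 r1_lt1] /andP[r2_gt0 r2_lt1] dF.
pose rad s := (1 - s) * r1 + s * r2.
pose psi s t := ((rad s)%:C)%C * turn t.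
have rad01 s : 0 <= s <= 1 -> 0 < rad s < 1.
  case/andP => s0 s1; rewrite /rad.
  have [->|sn0] := eqVneq s 0; first by rewrite subr0 mul1r mul0r addr0 r1_gt0.
  have {}s0 : 0 < s by rewrite lt_def sn0.
  apply/andP; split; first by rewrite ltr_wpDl ?mulr_ge0 ?mulr_gt0//; lra.
  have h1 : (1 - s) * r1 <= 1 - s by rewrite ler_piMr ?subr_ge0// ltW.
  have h2 : s * r2 < s by rewrite gtr_pMr.
  by lra.
have K0 : 0 <= 1 + 4 * pi :> R by have := pi_ge0 R; lra.
have psi_lip s t s' t' : 0 <= s <= 1 -> 0 <= t <= 1 -> 0 <= s' <= 1 ->
    0 <= t' <= 1 ->
    normc (psi s t - psi s' t') <= (1 + 4 * pi) * (`|s - s'| + `|t - t'|).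
  move=> s01 _ s'01 _; rewrite /psi.
  have -> : ((rad s)%:C)%C * turn t - ((rad s')%:C)%C * turn t' =
     ((rad s - rad s')%:C)%C * turn t + ((rad s')%:C)%C * (turn t - turn t').
    by rewrite rmorphB; ring.
  apply: (le_trans (normcD_le _ _)); rewrite !normcM !normc_real normc_turn mulr1.
  have /andP[rs0 rs1] := rad01 _ s'01.
  have h1 : `|rad s - rad s'| <= `|s - s'|.
    have -> : rad s - rad s' = (s - s') * (r2 - r1) by rewrite /rad; ring.
    by rewrite normrM ler_piMr// ler_norml; apply/andP; split; lra.
  have h2 : `|rad s'| * normc (turn t - turn t') <= 4 * pi * `|t - t'|.
    apply: le_trans (turn_lipschitz t t').
    by rewrite ler_piMl ?normc_ge0// gtr0_norm// ltW.
  have h3 : 0 <= 4 * pi * `|s - s'| by rewrite !mulr_ge0// pi_ge0.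
  have h4 := normr_ge0 (t - t').
  by rewrite mulrDl mul1r mulrDr; lra.
have dpsi s t : 0 <= s <= 1 -> 0 <= t <= 1 ->
    differentiable (fun z => F z / z) (psi s t).
  move=> /rad01/andP[rs0 rs1] _.
  have npsi : normc (psi s t) = rad s.
    by rewrite normcM normc_turn mulr1 normc_real gtr0_norm.
  have psi0 : psi s t != 0 by rewrite -normc_gt0 npsi.
  apply: differentiableM.
    by apply: dF => //; rewrite -[unit_disc _ _]/(is_true (normc _ < 1)) npsi.
  by apply: differentiableV.
apply/cvg_normcP => e e0.
have [N0 N0P] := goursat_square psi_lip K0 e0 dpsi.
exists (maxn N0 2) => // N; rewrite /= geq_max => /andP[/N0P + N2].
rewrite subr0 /dyadic_sum grid_sum_boundary big1 ?add0r; last first.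
  move=> i _; rewrite /dyadic_node !mul0r !mulr0 !addr0 !add0r !mul1r.
  by rewrite natrX divff ?expf_neq0// /psi turn1 turn0 subrr.
have psi0E j : dyadic_node psi 0 0 1 N 0 j = (r1%:C)%C * dyadic_root R N ^+ j.
  rewrite /dyadic_node !mul0r mulr0 addr0 !add0r mul1r /psi dyadic_rootX.
  by rewrite /rad subr0 mul1r mul0r addr0.
have psi1E j : dyadic_node psi 0 0 1 N (2 ^ N) j = (r2%:C)%C * dyadic_root R N ^+ j.
  rewrite /dyadic_node !add0r !mul1r natrX divff ?expf_neq0// /psi dyadic_rootX.
  by rewrite /rad subrr mul1r mul0r add0r.
under eq_bigr do rewrite !psi0E !psi1E.
rewrite sumrB !circle_edge_sum ?gt_eqF// -mulrBr -mulrBr !normcM.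
rewrite normcX (normc_nat R 2); have := dyadic_root_gap R N2.
rewrite mulrCA mulrA; set u := _ * normc _; set v := normc _ => u8 uv.
have v0 : 0 <= v by apply: normc_ge0.
by apply: le_trans uv; rewrite ler_peMl//; lra.
Qed.

(** On a small circle the mean is close to the limit at the centre. *)
Lemma circle_mean_cvg F r (l : C) : 0 < r < 1 ->
    (forall z, D z -> z != 0 -> differentiable F z) ->
    F z @[z --> 0^'] --> l -> circle_mean F N r @[N --> \oo] --> l.
Proof.
move=> r01 dF /cvg_normcP Fl; apply/cvg_normcP => e e0.
have e20 : 0 < e / 2 by rewrite divr_gt0.
have /dnbhs0_normcP[d d0 dP] := Fl _ e20.
pose r1 := Num.min (d / 2) (2^-1).
have r1_gt0 : 0 < r1 by rewrite lt_min divr_gt0//= invr_gt0.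
have r1d : r1 < d by rewrite /r1 gt_min; apply/orP; left; lra.
have r11 : r1 < 1 by rewrite /r1 gt_min; apply/orP; right; lra.
have r1_01 : 0 < r1 < 1 by rewrite r1_gt0.
have /cvg_normcP/(_ _ e20) := circle_mean_radius r1_01 r01 dF.
apply: filterS => N; rewrite subr0 => h.
have near_l : normc (circle_mean F N r1 - l) <= e / 2.
  have -> : circle_mean F N r1 - l = circle_mean (fun z => F z - l) N r1.
    rewrite circle_meanD; congr (_ + _).
    rewrite /circle_mean sumr_const card_ord -[- l *+ _]mulr_natl natrX mulKf//.
  apply: normc_circle_mean; first exact: ltW.
  by move=> z zr; apply: dP; rewrite ?zr// -normc_gt0 zr.
have -> : circle_mean F N r - l =
  (circle_mean F N r - circle_mean F N r1) + (circle_mean F N r1 - l) by ring.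
by apply: (le_trans (normcD_le _ _)); lra.
Qed.

End CircleMeans.

(** * Schwarz lemmas of first and second order *)

Section Schwarz.
Variable R : realType.
Local Notation C := R[i].
Local Notation D := (unit_disc R).
Implicit Types (h : C -> C) (r : R).

Lemma align_direction (a b : C) : exists t d : C, [/\ normc t = 1, normc d = 1,
  a = d * ((normc a)%:C)%C & t * b = d * ((normc b)%:C)%C].
Proof.
pose dir (z : C) : C := if z == 0 then 1 else z / ((normc z)%:C)%C.
have dir1 z : normc (dir z) = 1.
  rewrite /dir; case: eqVneq => [_|z0]; first by rewrite normc1.
  by rewrite normcM normcV normc_real ger0_norm ?normc_ge0// divff// normc_eq0.
have dir0 z : dir z != 0 by rewrite -normc_gt0 dir1.
have dirE z : z = dir z * ((normc z)%:C)%C.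
  rewrite /dir; case: eqVneq => [->|z0]; first by rewrite normc0 mulr0.
  rewrite divfK//; apply: contra z0 => /eqP/complexI/eqP.
  by rewrite normc_eq0.
exists (dir a / dir b), (dir a); split => //.
  by rewrite normcM normcV !dir1 divr1.
by rewrite -mulrA; congr (_ * _); rewrite [X in _ * X]dirE mulKf.
Qed.

Lemma align_phase (a b : C) : exists2 t : C, normc t = 1 &
  normc (a + t * b) = normc a + normc b.
Proof.
have [t [d [t1 d1 aE bE]]] := align_direction a b; exists t => //.
rewrite bE {1}aE -mulrDr -rmorphD normcM d1 mul1r normc_real ger0_norm//.
by rewrite addr_ge0 ?normc_ge0.
Qed.

Lemma fejer_weight_ge0 (u : C) : normc u = 1 -> 0 <= 2 + u + u^-1.
Proof.
move=> u1; have -> : 2 + u + u^-1 = `|1 + u| ^+ 2; last by rewrite exprn_ge0.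
have u0 : u != 0 by rewrite -normc_gt0 u1.
have uJ : u^-1 = (u^*)%C by rewrite invc_norm normr_normc u1 expr1n invr1 mul1r.
have -> : `|1 + u| ^+ 2 = (1 + u) * (1 + u^-1).
  rewrite sqr_normc; congr (_ * _); rewrite uJ.
  by rewrite -[X in _ = X + _](conjc1 R); exact: (rmorphD (@conjc R)).
by field.
Qed.

Lemma sum_root_of_unity (x : C) m : x ^+ m = 1 -> x != 1 -> \sum_(i < m) x ^+ i = 0.
Proof.
move=> xm x1; apply: (mulfI (_ : x - 1 != 0)); first by rewrite subr_eq0.
by rewrite -subrX1 xm subrr mulr0.
Qed.

Lemma sum_dyadic_root N (s : bool) : (0 < N)%N ->
  \sum_(j < 2 ^ N) (if s then dyadic_root R N else (dyadic_root R N)^-1) ^+ j = 0.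
Proof.
move=> N0; set w := dyadic_root R N.
have w1 : w != 1.
  apply: turn_neq1; rewrite invr_gt0 exprn_gt0//= invf_lt1 ?exprn_gt0//.
  by rewrite -natrX ltr1n -{1}(expn0 2) ltn_exp2l.
by apply: sum_root_of_unity; case: s; rewrite ?exprVn ?dyadic_rootX1 ?invr1 ?invr_eq1.
Qed.

(** The nonnegative weight [2 + 2 Re (t r / z)] has mean [2] on the circle, so
    integrating against it at most doubles a bound. *)
Lemma circle_mean_fejer (F : C -> C) N r (t : C) (b : R) : 0 < r -> (0 < N)%N ->
    normc t = 1 -> (forall z, normc z = r -> normc (F z) <= b) ->
  normc (circle_mean (fun z => F z *
      (2 + t * (((r%:C)%C) / z) + (t * (((r%:C)%C) / z))^-1)) N r) <= 2 * b.
Proof.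
move=> r0 N0 t1 Fb; have M0 : 0 < 2 ^+ N :> R by rewrite exprn_gt0.
have b0 : 0 <= b.
  apply: le_trans (Fb (r%:C)%C _); rewrite ?normc_ge0//.
  by rewrite normc_real gtr0_norm.
set w := dyadic_root R N.
have w0 : w != 0 by apply: turn_neq0.
have t0 : t != 0 by rewrite -normc_gt0 t1.
have rC0 : (r%:C)%C != 0 by apply: contraTneq r0 => /complexI ->; rewrite ltxx.
pose u j := t * w ^- j.
have u1 j : normc (u j) = 1.
  by rewrite /u normcM t1 normcV normcX normc_dyadic_root expr1n invr1 mulr1.
have wt j : t * ((r%:C)%C / ((r%:C)%C * w ^+ j)) = u j.
  by rewrite /u; field; rewrite rC0 expf_neq0.
rewrite /circle_mean normcM normcV normcX (normc_nat R 2).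
rewrite ler_pdivrMl//; apply: (le_trans (normc_sum _ _ _)).
apply: (@le_trans _ _ (\sum_(j < 2 ^ N) b * normc (2 + u j + (u j)^-1))).
  apply: ler_sum => j _; rewrite wt normcM ler_wpM2r ?normc_ge0//.
  by apply: Fb; rewrite normcM normc_real normcX normc_dyadic_root expr1n mulr1 gtr0_norm.
rewrite -mulr_sumr [2 * b]mulrC mulrCA ler_wpM2l//.
suff -> : \sum_(j < 2 ^ N) normc (2 + u j + (u j)^-1) = 2 ^+ N * 2 by [].
apply: (@complexI R); rewrite rmorph_sum/= rmorphM rmorphXn rmorph_nat.
have E (j : 'I_(2 ^ N)) : true -> ((normc (2 + u j + (u j)^-1))%:C)%C =
    2 + t * (if false then w else w^-1) ^+ j + t^-1 * (if true then w else w^-1) ^+ j.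
  by move=> _; rewrite -normr_normc ger0_norm ?fejer_weight_ge0// /u invfM invrK exprVn.
rewrite (eq_bigr _ E) !big_split/= -!mulr_sumr.
by rewrite (sum_dyadic_root false N0) (sum_dyadic_root true N0) !mulr0 !addr0
  sumr_const card_ord natrX mulrDr mulr1.
Qed.

Lemma unit_discP (z : C) : D z <-> normc z < 1.
Proof. by []. Qed.

Lemma unit_disc0 : D 0.
Proof. by apply/unit_discP; rewrite normc0. Qed.

Lemma cvg_divid (V : normedModType C) (g : C -> V) : differentiable g 0 -> g 0 = 0 ->
  z^-1 *: g z @[z --> 0^'] --> derive1 g 0.
Proof.
move=> /derivable1_diffP dg g0; rewrite derive1E.
have := dg; rewrite /derivable/derive/= => cv.
apply: cvg_trans cv; apply: near_eq_cvg; near=> z => /=.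
by rewrite g0 subr0 addr0 [z *: _]mulr1.
Unshelve. all: by end_near.
Qed.

Lemma differentiable_div_id h z : differentiable h z -> z != 0 ->
  differentiable (fun z => h z / z) z.
Proof.
move=> dh z0; have dV : differentiable (fun y : C => y^-1) z := differentiable_Rinv z0.
exact: differentiableM dh dV.
Qed.

Section SelfMap.
Variable h : C -> C.
Hypotheses (hol : holomorphic_map D D h) (h0 : h 0 = 0).

Let dh z : D z -> differentiable h z. Proof. by move=> /hol[]. Qed.

Let h_lt1 z : D z -> normc (h z) < 1. Proof. by move=> /hol[]. Qed.

Lemma cvg_quotient : h z / z @[z --> 0^'] --> derive1 h 0.
Proof.
have := cvg_divid (dh unit_disc0) h0.
by under [X in X @ _ --> _ -> _]funext do rewrite [_ *: _]mulrC.
Qed.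

(** The means of [h z / z] tend to [h'(0)], and are at most [1 / r] on the
    circle of radius [r]. *)
Lemma schwarz_derivative : normc (derive1 h 0) <= 1.
Proof.
apply/ler_addgt0Pr => e e0.
pose r := (1 + e)^-1.
have r01 : 0 < r < 1 by rewrite invr_gt0 invf_lt1; lra.
have rE : r^-1 = 1 + e by rewrite invrK.
have cvm := circle_mean_cvg r01 (fun z Dz => differentiable_div_id (dh Dz)) cvg_quotient.
apply: (cvg_normc_le cvm) => e' e'0; near=> N.
apply: (@le_trans _ _ (1 + e)); last by lra.
apply: normc_circle_mean => [|z zr]; first by case/andP: r01 => /ltW.
rewrite normcM normcV zr rE -[leRHS]mul1r ler_wpM2r//; first by lra.
by apply/ltW/h_lt1/unit_discP; rewrite zr; case/andP: r01.
Unshelve. all: by end_near.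
Qed.

(** Write [h z / z = c0 + c1 z + ...]. Its mean against the nonnegative weight
    [2 + 2 Re (t r / z)] tends to [2 c0 + t r c1]; choosing the phase [t] gives
    [2 |c0| + r |c1| <= 2 / r]. The coefficient [c1] is replaced here by the
    means that converge to it. *)
Lemma schwarz_second_mean r (e : R) : 0 < r < 1 -> 0 < e ->
  \forall N \near \oo, normc (circle_mean (fun z => h z / z ^+ 2) N r)
     <= 2 * (1 - normc (derive1 h 0)) + e.
Proof.
move=> r01 e0; set a := derive1 h 0.
pose d := Num.min 1 (e / 12).
have d0 : 0 < d by rewrite lt_min ltr01 divr_gt0.
have d1 : d <= 1 by rewrite ge_min lexx.
have de : d <= e / 12 by rewrite ge_min lexx orbT.
pose r' := (1 + d)^-1.
have r'01 : 0 < r' < 1 by rewrite invr_gt0 invf_lt1; lra.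
have r'E : r'^-1 = 1 + d by rewrite invrK.
have /andP[r'_gt0 r'_lt1] := r'01.
have rC0 : (r'%:C)%C != 0 by apply: contraTneq r'_gt0 => /complexI ->; rewrite ltxx.
have e18 : 0 < e / 18 by rewrite divr_gt0.
have ch : h z @[z --> 0^'] --> (0 : C).
  have : h z @[z --> (0 : C)] --> h 0.
    exact: differentiable_continuous (dh unit_disc0).
  by rewrite h0; apply: cvg_trans; apply: cvg_within_filter.
have := circle_mean_cvg r'01 (fun z Dz _ => dh Dz) ch.
move=> /cvg_normcP/(_ _ e18) cvm1.
have := circle_mean_cvg r'01 (fun z Dz => differentiable_div_id (dh Dz)) cvg_quotient.
move=> /cvg_normcP/(_ _ e18) cvm0.
have dh2 z : D z -> z != 0 -> differentiable (fun z => h z / z ^+ 2) z.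
  move=> Dz z0; apply: differentiableM; first exact: dh.
  by apply: differentiableV; rewrite ?expf_neq0//; apply: differentiableX.
have /cvg_normcP/(_ _ e18) cvr := circle_mean_radius r'01 r01 dh2.
near=> N.
have cvr' : normc (circle_mean (fun z => h z / z ^+ 2) N r -
   circle_mean (fun z => h z / z ^+ 2) N r' - 0) <= e / 18 by near: N.
have cvm0' : normc (circle_mean (fun z => h z / z) N r' - a) <= e / 18 by near: N.
have cvm1' : normc (circle_mean h N r' - 0) <= e / 18 by near: N.
have N0 : (0 < N)%N by near: N; exists 1%N.
rewrite subr0 in cvr'; rewrite subr0 in cvm1'.
set A := circle_mean _ N r' in cvr'; set B := circle_mean _ N r in cvr' *.
set c0 := circle_mean _ N r' in cvm0'; set c1 := circle_mean _ N r' in cvm1'.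
have [t t1 tP] := align_phase (2 * c0) ((r'%:C)%C * A).
have t0 : t != 0 by rewrite -normc_gt0 t1.
have hb z : normc z = r' -> normc (h z / z) <= 1 + d.
  move=> zr; rewrite normcM normcV zr r'E -[leRHS]mul1r ler_wpM2r//; first by lra.
  by apply/ltW/h_lt1/unit_discP; rewrite zr.
have := circle_mean_fejer r'_gt0 N0 t1 hb.
have -> : circle_mean (fun z => h z / z * (2 + t * ((r'%:C)%C / z)
      + (t * ((r'%:C)%C / z))^-1)) N r' =
    2 * c0 + t * ((r'%:C)%C * A) + t^-1 * ((r'%:C)%C^-1 * c1).
  rewrite /c0 /A /c1 -!circle_meanZ -!circle_meanD /circle_mean.
  congr (_ * _); apply: eq_bigr => j _.
  set z := _ * _ ^+ _; have z0 : z != 0.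
    by rewrite mulf_neq0 ?expf_neq0//; exact: turn_neq0.
  by field; rewrite t0 rC0 z0.
set S := _ + t * _ in tP *; set T := t^-1 * _ => STle.
have TE : normc T <= (1 + d) * (e / 18).
  rewrite /T 2!normcM !normcV t1 invr1 mul1r normc_real gtr0_norm// r'E.
  by rewrite ler_wpM2l//; lra.
have Sle : normc S <= 2 * (1 + d) + (1 + d) * (e / 18).
  have -> : S = (S + T) - T by rewrite addrK.
  by apply: (le_trans (normcB_le _ _)); exact: lerD.
have c0le : normc a <= normc c0 + e / 18.
  have -> : a = c0 - (c0 - a) by ring.
  by apply: (le_trans (normcB_le _ _)); rewrite lerD2l.
have Ble : normc B <= e / 18 + normc A.
  have -> : B = (B - A) + A by rewrite subrK.
  by apply: (le_trans (normcD_le _ _)); rewrite lerD2r.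
have Ale : normc A <= (1 + d) * (2 * (1 + d) + (1 + d) * (e / 18) - 2 * normc c0).
  have r'1 : (1 + d) * r' = 1 by rewrite divff//; lra.
  have -> : normc A = (1 + d) * (r' * normc A) by rewrite mulrA r'1 mul1r.
  rewrite ler_wpM2l//; first by lra.
  move: tP; rewrite [normc (2 * c0)]normcM [normc (_ * A)]normcM.
  rewrite (normc_nat R 2) normc_real gtr0_norm// => SE.
  by move: Sle; rewrite SE; lra.
have a1 := schwarz_derivative; have a0 := normc_ge0 a.
rewrite -/a in a1 *.
move: (normc a) (normc A) (normc B) (normc c0) a0 a1 c0le Ble Ale => na nA nB nc.
move=> na0 na1 hc hB hA.
have dd : d * d <= d by rewrite ler_piMl// ltW.
have de1 : d * e <= e by rewrite ler_piMl// ltW.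
have dde : d * (d * e) <= d * e by rewrite ler_piMl// mulr_ge0// ltW.
have dna : 0 <= d * na by rewrite mulr_ge0// ltW.
have hdc : d * na <= d * nc + d * e / 18.
  by rewrite -mulrA -mulrDr ler_wpM2l// ltW.
by lra.
Unshelve. all: by end_near.
Qed.

End SelfMap.

(** In the application the quotients [h i z / z ^+ 2] may be unbounded near 0,
    and only their combination has a limit; the estimate is therefore made on circle
    means, where each [h i] can be bounded separately. *)
Lemma schwarz_second (I : finType) (h : I -> C -> C) (m : I -> C) (l : C) :
    (forall i, holomorphic_map D D (h i)) -> (forall i, h i 0 = 0) ->
    (\sum_i m i * h i z) / z ^+ 2 @[z --> 0^'] --> l ->
  normc l <= \sum_i normc (m i) * (2 * (1 - normc (derive1 (h i) 0))).
Proof.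
move=> hol h0 cvl.
have r01 : 0 < (2^-1 : R) < 1 by rewrite invr_gt0 invf_lt1; lra.
have dH z : D z -> z != 0 -> differentiable (fun z => (\sum_i m i * h i z) / z ^+ 2) z.
  move=> Dz z0; apply: differentiableM.
    have -> : (fun z => \sum_i m i * h i z) = \sum_i (fun z => m i * h i z).
      by apply/funext => y; rewrite fct_sumE.
    apply: (big_ind (fun f : C -> C => differentiable f z)) => [|f g df dg|i _].
    - exact: differentiable_cst.
    - exact: differentiableD.
    - by apply: differentiableM; [exact: differentiable_cst|case: (hol i z Dz)].
  by apply: differentiableV; rewrite ?expf_neq0//; apply: differentiableX.
have cvm := circle_mean_cvg r01 dH cvl.
apply: (cvg_normc_le cvm) => e e0.
pose M := 1 + \sum_i normc (m i).
have M0 : 0 < M by rewrite ltr_wpDr// sumr_ge0// => i _; apply: normc_ge0.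
have eM0 : 0 < e / M by rewrite divr_gt0.
have : \forall N \near \oo, forall i,
  normc (circle_mean (fun z => h i z / z ^+ 2) N 2^-1)
     <= 2 * (1 - normc (derive1 (h i) 0)) + e / M.
  by apply: filter_forall => i; exact: schwarz_second_mean.
apply: filterS => N hN.
have -> : (fun z => (\sum_i m i * h i z) / z ^+ 2) =
   (fun z => \sum_i m i * (h i z / z ^+ 2)).
  by apply/funext => z; rewrite mulr_suml; apply: eq_bigr => i _; rewrite mulrA.
rewrite circle_mean_sum; apply: (le_trans (normc_sum _ _ _)).
apply: (@le_trans _ _ (\sum_i normc (m i) * (2 * (1 - normc (derive1 (h i) 0)) + e / M))).
  by apply: ler_sum => i _; rewrite circle_meanZ normcM ler_wpM2l ?normc_ge0.
under eq_bigr do rewrite mulrDr.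
rewrite big_split lerD2l/= -mulr_suml mulrA ler_pdivrMr// mulrC ler_wpM2l ?ltW//.
by rewrite /M ltrDr.
Qed.

End Schwarz.

(** * The functions [costara t] *)

Section GeneratingFunction.

Lemma prod_addM_subsets (A : comNzRingType) n (z : 'I_n -> A) (a b : A) :
  \prod_j (a + b * z j) =
  \sum_(J : {set 'I_n}) a ^+ (n - #|J|) * b ^+ #|J| * \prod_(j in J) z j.
Proof.
under eq_bigr do rewrite addrC.
rewrite bigA_distr; apply: eq_bigr => J _.
rewrite (bigID (mem J))/= mulrC -mulrA; congr (_ * _).
  rewrite (eq_bigr (fun=> a)) => [|j /negPf ->//].
  rewrite prodr_const; congr (_ ^+ _).
  transitivity #|~: J|; first by apply: eq_card => j; rewrite !inE.
  by rewrite cardsCs finset.setCK card_ord.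
rewrite (eq_bigr (fun j => b * z j)) => [|j ->//].
by rewrite big_split/= prodr_const.
Qed.

Lemma prod_addM_esym (A : comNzRingType) n (z : 'I_n -> A) (a b : A) :
  \prod_j (a + b * z j) = a ^+ n + \sum_(k < n) a ^+ (n - k.+1) * b ^+ k.+1
    * \sum_(J : {set 'I_n} | #|J| == k.+1) \prod_(j in J) z j.
Proof.
have cardJ (J : {set 'I_n}) : (#|J| < n.+1)%N.
  by have := max_card (mem J); rewrite card_ord.
rewrite prod_addM_subsets.
rewrite (partition_big (fun J : {set 'I_n} => inord #|J| : 'I_n.+1) xpredT)//=.
rewrite big_ord_recl/=; congr (_ + _).
  rewrite (big_pred1 (finset.set0 : {set 'I_n})) => [|J /=].
    by rewrite cards0 subn0 big_set0 !mulr1.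
  by rewrite -val_eqE/= inordK// cards_eq0.
apply: eq_bigr => k _; rewrite mulr_sumr.
have E (J : {set 'I_n}) : (inord #|J| == lift ord0 k :> 'I_n.+1) = (#|J| == k.+1).
  by rewrite -val_eqE/= inordK.
by apply: eq_big => [J|J]; rewrite E// => /eqP ->.
Qed.

End GeneratingFunction.

Section CostaraFunctions.
Variables (R : realType) (n : nat).
Local Notation C := R[i].
Local Notation V := 'rV[C]_n.
Implicit Types (S X z : V) (t : C).

Definition esym_poly S : {poly C} := 1 + \sum_(j < n) S 0 j *: 'X^(j.+1).

Lemma esym_poly_sigma z : esym_poly (sigma z) = \prod_(j < n) (1 + z 0 j *: 'X).
Proof.
transitivity (\prod_(j < n) (1 + 'X * (z 0 j)%:P)); last first.
  by apply: eq_bigr => j _; rewrite mulrC mul_polyC.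
rewrite prod_addM_esym expr1n; congr (_ + _); apply: eq_bigr => k _.
rewrite expr1n mul1r mxE -mul_polyC mulrC; congr (_ * _).
by rewrite rmorph_sum/=; apply: eq_bigr => J _; rewrite rmorph_prod.
Qed.

Definition costara_num t S : C := \sum_(j < n) j.+1%:R * S 0 j * t ^+ j.

Definition costara_den t S : C :=
  n%:R + \sum_(j < n) (n - j.+1)%:R * S 0 j * t ^+ j.+1.

Definition costara t S : C := costara_num t S / costara_den t S.

Lemma costara_numE t S : costara_num t S = ((esym_poly S)^`()).[t].
Proof.
rewrite /esym_poly derivD -polyC1 derivC add0r raddf_sum/= horner_sum.
apply: eq_bigr => j _; rewrite derivZ derivXn/= hornerZ hornerMn hornerXn.
by rewrite -[t ^+ j *+ _]mulr_natl mulrCA mulrA.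
Qed.

Lemma costara_denE t S :
  costara_den t S = n%:R * (esym_poly S).[t] - t * costara_num t S.
Proof.
rewrite /esym_poly hornerD -polyC1 hornerC mulrDr mulr1 horner_sum.
rewrite /costara_den -addrA; congr (_ + _); rewrite /costara_num !mulr_sumr -sumrB.
apply: eq_bigr => j _; rewrite natrB// hornerZ hornerXn exprS; ring.
Qed.

Lemma deriv_prod_horner (I : Type) (r : seq I) (F : I -> {poly C}) t :
    (forall i, (F i).[t] != 0) ->
  ((\prod_(i <- r) F i)^`()).[t] =
  (\prod_(i <- r) F i).[t] * \sum_(i <- r) (F i)^`().[t] / (F i).[t].
Proof.
move=> F0; elim: r => [|i r IH].
  by rewrite !big_nil -polyC1 derivC hornerC horner0 mulr0.
rewrite !big_cons derivM hornerD !hornerM IH.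
by field.
Qed.

(** The summands of [t P'(t) / P(t)], [P] the generating polynomial of
    [sigma z]. *)
Definition logder t z (j : 'I_n) : C := t * z 0 j / (1 + t * z 0 j).

Lemma horner_esym_poly_sigma t z :
  (esym_poly (sigma z)).[t] = \prod_(j < n) (1 + t * z 0 j).
Proof.
rewrite esym_poly_sigma horner_prod; apply: eq_bigr => j _.
by rewrite hornerD hornerZ hornerX -polyC1 hornerC mulrC.
Qed.

Lemma costara_num_sigma t z : (forall j, 1 + t * z 0 j != 0) ->
  t * costara_num t (sigma z) =
  (\prod_(j < n) (1 + t * z 0 j)) * \sum_(j < n) logder t z j.
Proof.
move=> tz0; rewrite costara_numE -horner_esym_poly_sigma esym_poly_sigma.
have hE j : (1 + z 0 j *: 'X : {poly C}).[t] = 1 + t * z 0 j.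
  by rewrite hornerD hornerZ hornerX -polyC1 hornerC mulrC.
rewrite deriv_prod_horner => [|j]; last by rewrite hE.
rewrite mulrCA mulr_sumr; congr (_ * _); apply: eq_bigr => j _.
by rewrite hE derivD -polyC1 derivC add0r derivZ derivX hornerZ hornerC mulr1 mulrA.
Qed.

Lemma costara_den_sigma t z : (forall j, 1 + t * z 0 j != 0) ->
  costara_den t (sigma z) =
  (\prod_(j < n) (1 + t * z 0 j)) * (n%:R - \sum_(j < n) logder t z j).
Proof.
move=> tz0; rewrite costara_denE costara_num_sigma// horner_esym_poly_sigma.
by rewrite mulrBr [n%:R * _]mulrC.
Qed.

(** A disc-to-half-plane equivalence: [|u| <= |a - u|] is a condition on the
    real part of [u]. It is used for the summands, with [a = 1], and for their
    sum, with [a = n]. *)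
Lemma normc_le_sub (a : R) (u : C) : 0 < a ->
  (normc u <= normc ((a%:C)%C - u)) = (2 * complex.Re u <= a).
Proof.
case: u => x y a0 /=; rewrite ler_sqrt ?addr_ge0 ?sqr_ge0// sub0r sqrrN lerD2r.
rewrite -subr_ge0; have -> : (a - x) ^+ 2 - x ^+ 2 = a * (a - 2 * x) by ring.
by rewrite pmulr_rge0// subr_ge0.
Qed.

Lemma normc_lt_sub (a : R) (u : C) : 0 < a ->
  (normc u < normc ((a%:C)%C - u)) = (2 * complex.Re u < a).
Proof.
case: u => x y a0 /=.
have [->|a2x] := eqVneq a (2 * x).
  by rewrite ltxx sub0r sqrrN; have -> : 2 * x - x = x by ring; rewrite ltxx.
rewrite ltNge [in RHS]ltNge; congr negb.
rewrite ler_sqrt ?addr_ge0 ?sqr_ge0// sub0r sqrrN lerD2r.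
rewrite -subr_ge0; have -> : x ^+ 2 - (a - x) ^+ 2 = a * (2 * x - a) by ring.
by rewrite pmulr_rge0// subr_ge0.
Qed.

Lemma logder_sub t z j : 1 + t * z 0 j != 0 ->
  1 - logder t z j = (1 + t * z 0 j)^-1.
Proof. by move=> tz0; rewrite /logder; field. Qed.

Section Bounds.
Variables (t : C) (z : V).
Hypotheses (t1 : normc t = 1) (tz0 : forall j, 1 + t * z 0 j != 0).

(** With [v = t z_j], the summand [v / (1 + v)] is closer to 0 than to 1, as
    [|v| <= 1]. *)
Lemma Re_logder_le j : normc (z 0 j) <= 1 -> 2 * complex.Re (logder t z j) <= 1.
Proof.
move=> z1; rewrite -normc_le_sub// (_ : ((1 : R)%:C)%C = 1)// logder_sub//.
rewrite /logder normcM normcM t1 mul1r ler_piMl ?normc_ge0//.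
Qed.

Lemma Re_logder_lt j : normc (z 0 j) < 1 -> 2 * complex.Re (logder t z j) < 1.
Proof.
move=> z1; rewrite -normc_lt_sub// (_ : ((1 : R)%:C)%C = 1)// logder_sub//.
by rewrite /logder normcM normcM t1 mul1r gtr_pMl// normc_gt0 invr_eq0.
Qed.

Hypothesis n_gt0 : (0 < n)%N.

Lemma Re_sum_logder : complex.Re (\sum_(j < n) logder t z j) =
  \sum_(j < n) complex.Re (logder t z j).
Proof.
apply: (big_morph (@complex.Re R) (id1 := 0) (op1 := +%R)) => // x y.
by case: x => a b; case: y.
Qed.

Let n_real : (n%:R : C) = ((n%:R : R)%:C)%C.
Proof. by rewrite rmorph_nat. Qed.

Let P0 : \prod_(j < n) (1 + t * z 0 j) != 0.
Proof. by apply/prodf_neq0 => j _. Qed.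

Lemma costara_den_neq0 : (forall j, normc (z 0 j) <= 1) ->
  costara_den t (sigma z) != 0.
Proof.
move=> z1; rewrite costara_den_sigma// mulf_neq0 ?P0// subr_eq0.
apply/eqP => /(congr1 (@complex.Re _)); rewrite Re_sum_logder n_real/= => nE.
have : 2 * (n%:R : R) <= n%:R.
  rewrite {1}nE mulr_sumr -[n in leRHS]card_ord -sumr_const.
  by apply: ler_sum => j _; apply: Re_logder_le.
have : 0 < (n%:R : R) by rewrite ltr0n.
by lra.
Qed.

Lemma costara_normE : normc (costara t (sigma z)) =
  normc (\sum_(j < n) logder t z j) / normc (n%:R - \sum_(j < n) logder t z j).
Proof.
rewrite /costara -[LHS]mul1r -t1 -normcM mulrA costara_num_sigma//.
rewrite costara_den_sigma// -mulf_div divff ?mul1r//.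
by rewrite normcM normcV.
Qed.

Lemma costara_le1 : (forall j, normc (z 0 j) <= 1) -> normc (costara t (sigma z)) <= 1.
Proof.
move=> z1; rewrite costara_normE ler_pdivrMr; last first.
  rewrite normc_gt0; have := costara_den_neq0 z1.
  by rewrite costara_den_sigma// mulf_eq0 negb_or => /andP[].
rewrite mul1r n_real normc_le_sub ?ltr0n// Re_sum_logder mulr_sumr.
rewrite -[n in leRHS]card_ord -sumr_const.
by apply: ler_sum => j _; apply: Re_logder_le.
Qed.

Lemma costara_lt1 : (forall j, normc (z 0 j) < 1) -> normc (costara t (sigma z)) < 1.
Proof.
move=> z1; rewrite costara_normE ltr_pdivrMr; last first.
  rewrite normc_gt0; have := costara_den_neq0 (fun j => ltW (z1 j)).
  by rewrite costara_den_sigma// mulf_eq0 negb_or => /andP[].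
rewrite mul1r n_real normc_lt_sub ?ltr0n// Re_sum_logder mulr_sumr.
rewrite -[n in ltRHS]card_ord -sumr_const.
apply: ltr_sum => [|j _]; last exact: Re_logder_lt.
by rewrite has_predT; case: index_enum (mem_index_enum (Ordinal n_gt0)).
Qed.

End Bounds.

Lemma one_add_neq0 t x : normc t = 1 -> normc x < 1 -> 1 + t * x != 0.
Proof.
move=> t1 x1; apply/eqP => /(canRL (addrK _)); rewrite sub0r => /(congr1 (@normc R)).
by rewrite normcNE normcM t1 mul1r normc1 => E; rewrite -E ltxx in x1.
Qed.

Lemma costara_num_is_linear t : linear (costara_num t).
Proof.
move=> a X Y; rewrite /costara_num scaler_sumr -big_split/=.
by apply: eq_bigr => j _; rewrite !mxE -[a *: _]/(a * _); ring.
Qed.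

HB.instance Definition _ t :=
  GRing.isLinear.Build C V C _ (costara_num t) (costara_num_is_linear t).

Lemma differentiable_costara_num t S : differentiable (costara_num t) S.
Proof.
have -> : costara_num t = \sum_(j < n) (fun S : V => (j.+1%:R * t ^+ j) * S 0 j).
  by apply/funext => X; rewrite fct_sumE; apply: eq_bigr => j _; ring.
apply: differentiable_sum => j; apply: differentiableM.
  exact: differentiable_cst.
exact: differentiable_coord.
Qed.

Lemma differentiable_costara_den t S : differentiable (costara_den t) S.
Proof.
have -> : costara_den t = (fun=> n%:R) +
   \sum_(j < n) (fun S : V => ((n - j.+1)%:R * t ^+ j.+1) * S 0 j).
  apply/funext => X; rewrite [RHS]/(_ + _) fct_sumE; congr (_ + _).
  by apply: eq_bigr => j _; ring.
apply: differentiableD; first exact: differentiable_cst.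
apply: differentiable_sum => j; apply: differentiableM.
  exact: differentiable_cst.
exact: differentiable_coord.
Qed.

Lemma costara_num0 t : costara_num t 0 = 0.
Proof. exact: linear0. Qed.

Lemma costara_den0 t : costara_den t 0 = n%:R.
Proof.
by rewrite /costara_den big1 ?addr0// => j _; rewrite mxE mulr0 mul0r.
Qed.

Lemma differentiable_costara t S : costara_den t S != 0 -> differentiable (costara t) S.
Proof.
move=> d0; apply: differentiableM; first exact: differentiable_costara_num.
exact: differentiableV (differentiable_costara_den t S) d0.
Qed.

(** The numerator is linear and the denominator takes the value [n] at 0. *)
Lemma diff_costara0 t X : (0 < n)%N -> 'd (costara t) 0 X = n%:R^-1 * costara_num t X.
Proof.
move=> n0; have nn0 : (n%:R : C) != 0 by rewrite pnatr_eq0 -lt0n.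
have dV : differentiable (fun S : V => (costara_den t S)^-1) 0.
  by apply: (differentiableV (differentiable_costara_den t 0)); rewrite costara_den0.
have E : costara t = (costara_num t : V -> C) * (fun S : V => (costara_den t S)^-1) by [].
rewrite E (diffM (differentiable_costara_num t 0) dV).
rewrite -[LHS]/(costara_num t 0 *: 'd (fun S : V => (costara_den t S)^-1) 0 X
   + (costara_den t 0)^-1 *: 'd (costara_num t) 0 X).
rewrite costara_num0 scale0r add0r costara_den0 diff_lin// => S.
exact: differentiable_continuous (differentiable_costara_num t S).
Qed.

Lemma costara_holomorphic t : normc t = 1 -> (0 < n)%N ->
  holomorphic_map (symmetrized_polydisc R n) (unit_disc R) (costara t).
Proof.
move=> t1 n0 _ [z zD <-].
have tz0 j : 1 + t * z 0 j != 0 by apply: one_add_neq0 => //; exact: zD.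
split; last by apply/unit_discP; apply: costara_lt1 => // j; exact: zD.
by apply: differentiable_costara; apply: costara_den_neq0 => // j; apply/ltW/zD.
Qed.

End CostaraFunctions.

(** * Comparison of the metrics with [rho] *)

Section Comparison.
Variables (R : realType) (n : nat).
Local Notation C := R[i].
Local Notation V := 'rV[C]_n.
Local Notation G := (symmetrized_polydisc R n).
Implicit Types (X : V) (t : C).

Lemma rho_values_bounded X : has_ubound
  [set normc (n%:R^-1 * \sum_(j < n) j.+1%:R * X 0 j * t ^+ j)
  | t in [set t : C | normc t = 1]].
Proof.
exists (normc (n%:R^-1 : C) * \sum_(j < n) normc (j.+1%:R * X 0 j)) => _ [t /= t1 <-].
rewrite normcM ler_wpM2l ?normc_ge0//; apply: (le_trans (normc_sum _ _ _)).
by apply: ler_sum => j _; rewrite normcM normcX t1 expr1n mulr1.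
Qed.

Lemma rho_ge X t : normc t = 1 -> normc (costara_num t X) / n%:R <= rho X.
Proof.
move=> t1; rewrite -(normc_nat R n) -normcV -normcM mulrC.
by apply: ub_le_sup; [exact: rho_values_bounded | exists t].
Qed.

Lemma rho_le X (b : R) :
  (forall t, normc t = 1 -> normc (costara_num t X) / n%:R <= b) -> rho X <= b.
Proof.
move=> Xb; apply: ge_sup.
  by exists (normc (n%:R^-1 * costara_num 1 X)), 1 => //=; exact: normc1.
move=> _ [t /= t1 <-]; rewrite -/(costara_num t X) normcM normcV normc_nat mulrC.
exact: Xb.
Qed.

Lemma costara_num_e t k : (1 <= k <= n)%N -> costara_num t (e R n k) = k%:R * t ^+ k.-1.
Proof.
case: k => // k /= kn; rewrite /costara_num (bigD1 (Ordinal kn))//= mxE eqxx mulr1.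
rewrite big1 ?addr0// => j /negPf jk; rewrite mxE eqSS.
have -> : (nat_of_ord j == k) = false by rewrite -jk -val_eqE.
by rewrite mulr0 mul0r.
Qed.

Lemma L_decomp k l X : X \in L R n k l -> exists a b : C, X = a *: e R n k + b *: e R n l.
Proof.
rewrite /L span_cons span_seq1 => /memv_addP[u /vlineP[a ->]] [v /vlineP[b ->]] ->.
by exists a, b.
Qed.

Lemma holomorphic_comp (D : set C) (E : set V) (f : V -> C) (g : C -> V) (B : set C) :
  holomorphic_map E B f -> holomorphic_map D E g -> holomorphic_map D B (f \o g).
Proof.
move=> hf hg z /hg[dg /hf[df Bf]]; split => //.
exact: differentiable_comp.
Qed.

Lemma derive1_comp_diff (f : V -> C) (g : C -> V) : differentiable g 0 ->
  differentiable f (g 0) -> derive1 (f \o g) 0 = 'd f (g 0) (derive1 g 0).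
Proof.
move=> dg df; rewrite (derive1E' (differentiable_comp dg df)) (derive1E' dg).
by rewrite diff_comp.
Qed.

Lemma diff_le_kobayashi (f : V -> C) X :
    holomorphic_map G (unit_disc R) f -> f 0 = 0 ->
  ((normc ('d f 0 X))%:E <= kobayashi G 0 X)%E.
Proof.
move=> hf f0; apply: le_ereal_inf_tmp => _ [a [g [hg g0 <-]] <-].
rewrite lee_fin linearZ normcM ler_piMr ?normc_ge0//.
have [dg Gg] := hg 0 (unit_disc0 R); have [df _] := hf _ Gg.
rewrite -[in 'd f _]g0 -derive1_comp_diff//.
by apply: schwarz_derivative; [exact: holomorphic_comp hf hg | rewrite /= g0].
Qed.

(** Each [X |-> |f'(0) X|] is one of the pseudonorms of which the
    Kobayashi-Buseman metric is the supremum. *)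
Lemma caratheodory_le_kobayashi_buseman X :
  (caratheodory G 0 X <= kobayashi_buseman G 0 X)%E.
Proof.
apply: ge_ereal_sup => _ [f [hf f0] <-]; apply: ereal_sup_ubound.
exists (fun X => normc ('d f 0 X)) => //; split; last first.
  by move=> Y; exact: diff_le_kobayashi.
split=> [Y|a Y|Y Z]; first exact: normc_ge0.
  by rewrite linearZ normcM.
by rewrite linearD normcD_le.
Qed.

Lemma caratheodory_le_kobayashi X : (caratheodory G 0 X <= kobayashi G 0 X)%E.
Proof.
exact: le_trans (caratheodory_le_kobayashi_buseman X) (kobayashi_buseman_le _ _ _).
Qed.

Hypothesis n_gt0 : (0 < n)%N.

Lemma rho_le_caratheodory X : ((rho X)%:E <= caratheodory G 0 X)%E.
Proof.
have le_t t : normc t = 1 ->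
    ((normc (costara_num t X) / n%:R)%:E <= caratheodory G 0 X)%E.
  move=> t1; apply: ereal_sup_ubound; exists (costara t).
    split; first exact: costara_holomorphic.
    by rewrite /costara costara_num0 mul0r.
  by rewrite diff_costara0// normcM normcV normc_nat mulrC.
move: le_t; case: (caratheodory G 0 X) => [g| |] le_t.
- by rewrite lee_fin; apply: rho_le => t /le_t.
- by rewrite leey.
- by have := le_t 1 (normc1 R).
Qed.

End Comparison.

(** * Divisors of [n] *)

Section DiscsThroughBasisVectors.
Variables (R : realType) (n k m : nat).
Hypotheses (k_gt0 : (0 < k)%N) (m_gt0 : (0 < m)%N) (nE : n = (k * m)%N).
Local Notation C := R[i].
Local Notation V := 'rV[C]_n.

Lemma differentiable_exprn (z : C) i : differentiable (fun z : C => z ^+ i) z.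
Proof.
case: i => [|i].
  exact: (differentiable_cst (1 : C)).
by have := @differentiableX _ _ (@id C) i z; rewrite exprfctE; apply.
Qed.

(** The polynomial map whose value at [z] has generating polynomial
    [(1 + z X^k)^m]. *)
Definition binomial_disc (z : C) : V :=
  \sum_(i < m) ('C(m, i.+1)%:R * z ^+ i.+1) *: e R n (k * i.+1).

Lemma differentiable_poly_curve (c : 'I_m -> C) (p : 'I_m -> nat) (v : 'I_m -> V) z :
  differentiable (fun z : C => \sum_(i < m) (c i * z ^+ p i) *: v i) z.
Proof.
have -> : (fun z : C => \sum_(i < m) (c i * z ^+ p i) *: v i) =
    \sum_(i < m) (fun z : C => (c i * z ^+ p i) *: v i).
  by apply/funext => y; rewrite fct_sumE.
apply: differentiable_sum => i; apply: differentiableZl.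
apply: differentiableM; first exact: differentiable_cst.
exact: differentiable_exprn.
Qed.

Lemma binomial_disc0 : binomial_disc 0 = 0.
Proof.
by rewrite /binomial_disc big1// => i _; rewrite expr0n mulr0 scale0r.
Qed.

Lemma derive_binomial_disc : derive1 binomial_disc 0 = m%:R *: e R n k.
Proof.
pose q z := \sum_(i < m) ('C(m, i.+1)%:R * z ^+ i) *: e R n (k * i.+1).
have dq : differentiable q 0 by exact: differentiable_poly_curve.
have q0 : q 0 = m%:R *: e R n k.
  rewrite /q (bigD1 (Ordinal m_gt0))//= bin1 expr0 mulr1 muln1 big1 ?addr0// => i.
  rewrite -val_eqE/= => i0.
  by rewrite expr0n (negPf i0) mulr0 scale0r.
have db : differentiable binomial_disc 0 by exact: differentiable_poly_curve.
have cvb := cvg_divid db binomial_disc0.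
have cvq : q z @[z --> 0^'] --> m%:R *: e R n k.
  have : q z @[z --> (0 : C)] --> q 0 by exact: differentiable_continuous dq.
  by rewrite q0; apply: cvg_trans; apply: cvg_within_filter.
apply: (cvg_unique _ cvb); first exact: norm_hausdorff.
apply: cvg_trans cvq; apply: near_eq_cvg; near=> z.
have z0 : z != 0 by near: z; exact: nbhs_dnbhs_neq.
rewrite /binomial_disc scaler_sumr; apply: eq_bigr => i _.
by rewrite scalerA exprS mulrCA [z^-1 * _]mulrA mulVf ?mul1r// mulrCA.
Unshelve. all: by end_near.
Qed.

(** The reversed generating polynomial is monic, so that it can be factored;
    the roots are the opposites of the [z_j]. *)
Lemma coef_rev_row (S : V) (j : 'I_n) :
  ('X^n + \sum_(i < n) S 0 i *: 'X^(n - i.+1) : {poly C})`_(n - j.+1) = S 0 j.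
Proof.
rewrite coefD coefXn coef_sum (bigD1 j)//= coefZ coefXn eqxx mulr1.
have -> : (n - j.+1 == n)%N = false.
  by apply/negbTE; rewrite neq_ltn; have := ltn_ord j; lia.
rewrite add0r big1 ?addr0// => i ij; rewrite coefZ coefXn.
have -> : (n - j.+1 == n - i.+1)%N = false.
  apply/negbTE; move: ij; rewrite -val_eqE/=.
  by have := ltn_ord i; have := ltn_ord j; lia.
by rewrite mulr0.
Qed.

Lemma sigma_rev_poly (z : V) :
  'X^n + \sum_(i < n) sigma z 0 i *: 'X^(n - i.+1) = \prod_(j < n) ('X + (z 0 j)%:P).
Proof.
transitivity (\prod_(j < n) ('X + 1 * (z 0 j)%:P)); last first.
  by apply: eq_bigr => j _; rewrite mul1r.
rewrite prod_addM_esym; congr (_ + _); apply: eq_bigr => i _.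
rewrite expr1n mulr1 mxE -mul_polyC mulrC; congr (_ * _).
by rewrite rmorph_sum/=; apply: eq_bigr => J _; rewrite rmorph_prod.
Qed.

Lemma binomial_disc_rev_poly (z : C) :
  'X^n + \sum_(i < n) binomial_disc z 0 i *: 'X^(n - i.+1) = ('X^k + z%:P) ^+ m.
Proof.
rewrite exprDn big_ord_recl subn0 expr0 mulr1 bin0 mulr1n -exprM -nE; congr (_ + _).
rewrite /binomial_disc; under eq_bigr do rewrite summxE scaler_suml.
rewrite exchange_big/=; apply: eq_bigr => i _.
have kin : (k * i.+1 <= n)%N by rewrite nE leq_mul.
have ki : (0 < k * i.+1)%N by rewrite muln_gt0 k_gt0.
have lt : ((k * i.+1).-1 < n)%N by rewrite prednK.
rewrite (bigD1 (Ordinal lt))//= big1 ?addr0 => [|j].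
  rewrite !mxE/= prednK// eqxx mulr1 -exprM /bump leq0n add1n.
  have -> : (k * (m - i.+1) = n - k * i.+1)%N by rewrite nE mulnBr.
  by rewrite -rmorphXn/= [in RHS]mulrC mul_polyC -[RHS]scaler_nat scalerA.
rewrite -val_eqE/= => ji; rewrite !mxE.
have -> : (j.+1 == k * i.+1)%N = false.
  by apply/negbTE; apply: contra ji => /eqP <-.
by rewrite mulr0 scale0r.
Qed.

(** The roots of [(X^k + z)^m] are [k]-th roots of [- z], of modulus less
    than 1. *)
Lemma binomial_disc_polydisc (z : C) : normc z < 1 ->
  symmetrized_polydisc R n (binomial_disc z).
Proof.
move=> z1; pose P : {poly C} := ('X^k + z%:P) ^+ m.
have monP : P \is monic by rewrite monic_exp// monicXnaddC.
have szP : size P = n.+1.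
  rewrite -[LHS]prednK ?size_poly_gt0 ?monic_neq0//.
  by rewrite size_exp size_XnaddC// nE.
have [r rP] := closed_field_poly_normal P.
rewrite (monicP monP) scale1r in rP.
have szr : size r = n by move: szP; rewrite rP size_prod_XsubC => -[].
pose w : V := \row_j (- r`_j).
have wP : \prod_(j < n) ('X + (w 0 j)%:P) = P.
  rewrite rP (big_nth 0) szr big_mkord; apply: eq_bigr => j _.
  by rewrite mxE polyCN.
exists w => [j|].
  have jr : (j < size r)%N by rewrite szr.
  have : root P r`_j by rewrite rP root_prod_XsubC mem_nth.
  rewrite rootE horner_exp expf_eq0 m_gt0/= hornerD hornerXn hornerC addr_eq0.
  move=> /eqP/(congr1 (@normc R)); rewrite normcX normcNE => E.
  rewrite mxE; apply/unit_discP; rewrite normcNE ltNge; apply/negP => r1.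
  by have := exprn_ege1 k r1; rewrite E leNgt z1.
apply/rowP => j; rewrite -[LHS](coef_rev_row (sigma w)) sigma_rev_poly wP.
by rewrite /P -binomial_disc_rev_poly coef_rev_row.
Qed.

Lemma kobayashi_e_le (a : C) :
  (kobayashi (symmetrized_polydisc R n) 0 (a *: e R n k)
    <= (normc a * (k%:R / n%:R))%:E)%E.
Proof.
apply: ereal_inf_lbound; exists (a / m%:R).
  exists binomial_disc; split; last 1 first.
  - by rewrite derive_binomial_disc scalerA divfK// pnatr_eq0 -lt0n.
  - move=> z z1; split; first exact: differentiable_poly_curve.
    exact: binomial_disc_polydisc.
  - exact: binomial_disc0.
congr EFin; rewrite normcM normcV normc_nat nE natrM invfM.
by rewrite [k%:R * _]mulrA divff ?mul1r// pnatr_eq0 -lt0n.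
Qed.

End DiscsThroughBasisVectors.

Section DivisibleCase.
Variables (R : realType) (n : nat).
Hypothesis n_gt0 : (0 < n)%N.
Local Notation C := R[i].
Local Notation G := (symmetrized_polydisc R n).

Lemma kobayashi_e_dvd_le k (a : C) : (1 <= k <= n)%N -> (k %| n)%N ->
  (kobayashi G 0 (a *: e R n k) <= (normc a * (k%:R / n%:R))%:E)%E.
Proof.
move=> /andP[k0 kn] /dvdnP[m nE]; apply: (@kobayashi_e_le _ _ _ m) => //.
  by move: n_gt0; rewrite nE muln_gt0 => /andP[].
by rewrite mulnC.
Qed.

Lemma rho_e k : (1 <= k <= n)%N -> rho (e R n k) = k%:R / n%:R.
Proof.
move=> kn; apply/eqP; rewrite eq_le; apply/andP; split.
  apply: rho_le => t t1.
  by rewrite costara_num_e// normcM normc_nat normcX t1 expr1n mulr1.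
apply: le_trans (rho_ge _ (normc1 R)).
by rewrite costara_num_e// normcM normc_nat normcX normc1 expr1n mulr1.
Qed.

Lemma unimodular_root (t : C) p : (0 < p)%N -> normc t = 1 ->
  exists2 x : C, normc x = 1 & x ^+ p = t.
Proof.
move=> p0 t1; have [x xP] := @solve_monicpoly C p (fun i => if i == 0%N then t else 0) p0.
have {}xP : x ^+ p = t.
  rewrite xP; case: p p0 {xP} => // p _; rewrite big_ord_recl/= expr0 mulr1.
  by rewrite big1 ?addr0// => i _; rewrite mul0r.
exists x => //; apply/eqP; rewrite -(pexpr_eq1 p0 (normc_ge0 x)).
by rewrite -normcX xP t1.
Qed.

(** Moving [t] along the circle rotates [t ^+ (l - k)], so the two terms can be
    given the same phase. *)
Lemma rho_two_ge k l (a b : C) : (1 <= k <= n)%N -> (1 <= l <= n)%N -> k != l ->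
  (k%:R * normc a + l%:R * normc b) / n%:R <= rho (a *: e R n k + b *: e R n l).
Proof.
wlog kl : k l a b / (k < l)%N.
  move=> H hk hl kl; have [/H|lk|/eqP] := ltngtP k l; [exact| |by rewrite (negPf kl)].
  by rewrite addrC [_ *: _ + _]addrC; apply: H; rewrite // eq_sym.
move=> hk hl _.
have [t t1 tE] := align_phase (k%:R * a) (l%:R * b).
have lk0 : (0 < l - k)%N by rewrite subn_gt0.
have [x x1 xt] := unimodular_root lk0 t1.
apply: le_trans (rho_ge _ x1); rewrite ler_wpM2r ?invr_ge0//.
have -> : costara_num x (a *: e R n k + b *: e R n l) =
    x ^+ k.-1 * (k%:R * a + t * (l%:R * b)).
  rewrite linearD !linearZ/= !costara_num_e// -xt.
  have -> : l.-1 = (k.-1 + (l - k))%N by lia.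
  by rewrite exprD -![_ *: _]/(_ * _); ring.
by rewrite normcM normcX x1 expr1n mul1r tE !normcM !normc_nat.
Qed.

Lemma kobayashi_buseman_two_le k l (a b : C) :
  (1 <= k <= n)%N -> (1 <= l <= n)%N -> (k %| n)%N -> (l %| n)%N ->
  (kobayashi_buseman G 0 (a *: e R n k + b *: e R n l) <=
    ((k%:R * normc a + l%:R * normc b) / n%:R)%:E)%E.
Proof.
move=> hk hl kn ln; apply: ge_ereal_sup => _ [q [[q0 qZ qD] qk] <-].
rewrite lee_fin; apply: (le_trans (qD _ _)); rewrite mulrDl; apply: lerD.
  rewrite mulrAC mulrC -lee_fin; apply: le_trans (kobayashi_e_dvd_le a hk kn).
  exact: qk.
rewrite mulrAC mulrC -lee_fin; apply: le_trans (kobayashi_e_dvd_le b hl ln).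
exact: qk.
Qed.

Lemma kobayashi_e_dvd k : (1 <= k <= n)%N -> (k %| n)%N ->
  kobayashi G 0 (e R n k) = (rho (e R n k))%:E.
Proof.
move=> hk kn; apply/eqP; rewrite eq_le; apply/andP; split.
  rewrite rho_e//; have := kobayashi_e_dvd_le 1 hk kn.
  by rewrite scale1r normc1 mul1r.
exact: le_trans (rho_le_caratheodory n_gt0 _) (caratheodory_le_kobayashi _).
Qed.

Lemma metrics_agree_dvd k l (X : 'rV[C]_n) :
  (1 <= k <= n)%N -> (1 <= l <= n)%N -> (k %| n)%N -> (l %| n)%N -> X \in L R n k l ->
  kobayashi_buseman G 0 X = caratheodory G 0 X /\ caratheodory G 0 X = (rho X)%:E.
Proof.
move=> hk hl kn ln /L_decomp[a [b XE]].
have le_rho : (kobayashi_buseman G 0 X <= (rho X)%:E)%E.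
  rewrite XE; have [kl|kl] := eqVneq k l; last first.
    apply: (le_trans (kobayashi_buseman_two_le a b hk hl kn ln)).
    by rewrite lee_fin; exact: rho_two_ge.
  rewrite -kl -scalerDl; apply: (le_trans (kobayashi_buseman_le _ _ _)).
  apply: (le_trans (kobayashi_e_dvd_le _ hk kn)); rewrite lee_fin.
  apply: le_trans (rho_ge _ (normc1 R)).
  rewrite linearZ/= costara_num_e// normcM normcM normc_nat normcX normc1 expr1n.
  by rewrite mulr1 mulrA.
have c_le := caratheodory_le_kobayashi_buseman X.
have r_le := rho_le_caratheodory n_gt0 X.
split; apply/eqP; rewrite eq_le.
  by rewrite c_le (le_trans le_rho r_le).
by rewrite r_le (le_trans c_le le_rho).
Qed.

End DivisibleCase.

(** * Indices that do not divide [n] *)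

Section NonDivisibleCase.
Variables (R : realType) (n : nat).
Hypothesis n_gt0 : (0 < n)%N.
Local Notation C := R[i].
Local Notation V := 'rV[C]_n.
Local Notation G := (symmetrized_polydisc R n).
Implicit Types (z S X : V) (t c : C).

Lemma coef0_esym_poly S : (esym_poly S)`_0 = 1.
Proof.
rewrite coefD coef1 eqxx coef_sum big1 ?addr0// => j _.
by rewrite coefZ coefXn mulr0.
Qed.

Lemma size_esym_poly_le S : (size (esym_poly S) <= n.+1)%N.
Proof.
apply: (leq_trans (size_polyD _ _)); rewrite geq_max size_poly1/=.
apply: (leq_trans (size_sum _ _ _)); apply/bigmax_leqP => j _.
by apply: (leq_trans (size_scale_leq _ _)); rewrite size_polyXn ltnS.
Qed.

(** The differential equation satisfied by [(1 + c X^k)^(n / k)]. Comparing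
    coefficients, a normalized polynomial solution has nonzero coefficients at
    all multiples of [k] unless [n] is one of them. *)
Lemma esym_poly_ode_dvd S (k : nat) c : (0 < k)%N -> c != 0 ->
  (esym_poly S)^`() = c *: ('X^(k.-1) * (n%:R *: esym_poly S - 'X * (esym_poly S)^`())) ->
  (k %| n)%N.
Proof.
move=> k0 c0 ode; apply: contraT => kn; set P := esym_poly S in ode.
have rec i : (i + k)%:R * P`_(i + k) = c * ((n%:R - i%:R) * P`_i).
  have := congr1 (fun p : {poly C} => p`_(i + k.-1)) ode.
  rewrite coef_deriv coefZ coefXnM ltnNge leq_addl/= addnK coefB coefZ coefXM.
  have -> : (i + k.-1).+1 = (i + k)%N by rewrite -addnS prednK.
  rewrite -[P`_(i + k) *+ _]mulr_natl => ->; congr (c * _); rewrite mulrBl; congr (_ - _).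
  by case: i => [|i]; [rewrite mul0r|rewrite /= coef_deriv mulr_natl].
have nz q : P`_(k * q) != 0.
  elim: q => [|q IH]; first by rewrite muln0 coef0_esym_poly oner_neq0.
  have := rec (k * q)%N; rewrite -mulnSr => E.
  have : c * ((n%:R - (k * q)%:R) * P`_(k * q)) != 0.
    rewrite !mulf_neq0// subr_eq0 eqr_nat.
    by apply: contra kn => /eqP ->; rewrite dvdn_mulr.
  by rewrite -E mulf_eq0 negb_or => /andP[].
have := nz n.+1; rewrite nth_default ?eqxx//.
by apply: (leq_trans (size_esym_poly_le S)); rewrite leq_pmull.
Qed.

(** The two sides are polynomials in [t] of degree less than [n + k], so equality
    on [T] makes them equal. *)
Lemma costara_constant_dvd S (k : nat) c (T : seq C) :
    (0 < k)%N -> c != 0 -> uniq T -> (n + k < size T)%N ->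
    {in T, forall t, costara_num t S = c * t ^+ k.-1 * costara_den t S} ->
  (k %| n)%N.
Proof.
move=> k0 c0 uT sT TE; apply: (@esym_poly_ode_dvd S _ c) => //.
set P := esym_poly S.
have sP : (size P <= n.+1)%N := size_esym_poly_le S.
have sdP : (size P^`() <= n)%N.
  by apply: (leq_trans (size_poly _ _)); rewrite -subn1 leq_subLR add1n.
apply/eqP; rewrite -subr_eq0; set A := _ - _.
have rootA t : t \in T -> root A t.
  have denE : (n%:R *: P - 'X * P^`()).[t] = costara_den t S.
    by rewrite costara_denE costara_numE hornerD hornerN hornerZ hornerM hornerX.
  move=> tT; rewrite rootE /A hornerD hornerN hornerZ hornerM hornerXn denE.
  by rewrite /P -costara_numE TE// !mulrA subrr.
have sA : (size A <= n + k)%N.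
  apply: (leq_trans (size_polyD _ _)); rewrite geq_max size_polyN.
  apply/andP; split; first by apply: (leq_trans sdP); rewrite leq_addr.
  apply: (leq_trans (size_scale_leq _ _)); apply: (leq_trans (size_polyMleq _ _)).
  rewrite size_polyXn addSn/= addnC.
  have : (size (n%:R *: P - 'X * P^`())%R <= n.+1)%N.
    apply: (leq_trans (size_polyD _ _)); rewrite geq_max size_polyN.
    rewrite (leq_trans (size_scale_leq _ _))//=.
    apply: (leq_trans (size_polyMleq _ _)); rewrite size_polyX addSn/= add1n ltnS.
    exact: sdP.
  by move: (size _) => s; case: (k) k0 => // k' _ /=; lia.
apply: contraTT sT => A0; rewrite -leqNgt; apply: leq_trans sA.
by apply: ltnW; apply: (max_poly_roots A0) => //; apply/allP.
Qed.

Lemma normc_parallelogram (a b : C) :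
  normc (a - b) ^+ 2 = 2 * normc a ^+ 2 + 2 * normc b ^+ 2 - normc (a + b) ^+ 2.
Proof.
case: a => a1 a2; case: b => b1 b2 /=.
by rewrite !sqr_sqrtr ?addr_ge0 ?sqr_ge0//; ring.
Qed.

Lemma normc_add_eq2 (a b : C) : normc a <= 1 -> normc b <= 1 -> 2 <= normc (a + b) -> a = b.
Proof.
move=> a1 b1 ab; apply/eqP; rewrite -subr_eq0 -normc_eq0 -sqrf_eq0 eq_le sqr_ge0 andbT.
rewrite normc_parallelogram.
have a2 : normc a ^+ 2 <= 1 by rewrite expr_le1 ?normc_ge0.
have b2 : normc b ^+ 2 <= 1 by rewrite expr_le1 ?normc_ge0.
have : 2 ^+ 2 <= normc (a + b) ^+ 2 by rewrite ler_pXn2r// nnegrE ?normc_ge0.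
by move: (normc _ ^+ 2) (normc _ ^+ 2) (normc _ ^+ 2) a2 b2 => x y w; lra.
Qed.

(** A mean of points of the unit disc, two of which are not nearly equal
    unimodular numbers, stays away from the unit circle. *)
Lemma normc_mean_pair N (B : 'I_N -> C) i j (h : R) :
    (forall l, normc (B l) <= 1) -> normc (B i + B j) <= 2 - h ->
  normc (N%:R^-1 * \sum_l B l) <= 1 - h / (2 * N%:R ^+ 2).
Proof.
move=> B1 Bij.
have N_gt0 : (0 < N)%N by apply: leq_ltn_trans (ltn_ord i).
have N0 : (N%:R : C) != 0 by rewrite pnatr_eq0 -lt0n.
have N2 : 0 < 2 * (N%:R : R) ^+ 2 by rewrite mulr_gt0// exprn_gt0// ltr0n.
have pairs : normc (\sum_(p : 'I_N * 'I_N) (B p.1 + B p.2)) <= 2 * N%:R ^+ 2 - h.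
  apply: (le_trans (normc_sum _ _ _)); rewrite (bigD1 (i, j))//=.
  have -> : 2 * N%:R ^+ 2 - h = (2 - h) + (2 * N%:R ^+ 2 - 2) by ring.
  apply: lerD; first exact: Bij.
  apply: (@le_trans _ _ (\sum_(p : 'I_N * 'I_N | p != (i, j)) 2)).
    apply: ler_sum => p _; apply: (le_trans (normcD_le _ _)).
    exact: (lerD (B1 p.1) (B1 p.2)).
  rewrite [leRHS](_ : _ = \sum_(p : 'I_N * 'I_N) 2 - 2).
    by rewrite [in leRHS](bigD1 (i, j))//= addrAC subrr add0r.
  by rewrite sumr_const card_prod card_ord -mulrnA !natrM expr2.
have avgE : \sum_(p : 'I_N * 'I_N) (B p.1 + B p.2) =
    (2 * N%:R ^+ 2) * (N%:R^-1 * \sum_l B l).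
  rewrite -(pair_bigA _ (fun x y : 'I_N => B x + B y))/=.
  under eq_bigr do rewrite big_split/= sumr_const card_ord.
  rewrite big_split/= sumr_const card_ord -mulr_natr sumrMnl -mulr_natr.
  by field.
move: pairs; rewrite avgE normcM.
have -> : normc (2 * N%:R ^+ 2 : C) = 2 * N%:R ^+ 2.
  by rewrite normcM normcX !normc_nat.
rewrite -ler_pdivlMl// => /le_trans; apply.
by rewrite mulrBr mulVf ?gt_eqF// [_ * h]mulrC.
Qed.

Section Average.
Variables (k : nat) (N : nat).
Hypotheses (k_gt0 : (0 < k)%N) (N_gt0 : (0 < N)%N).

Definition angle (j : 'I_N) : C := turn (j%:R / N%:R : R).

Lemma normc_angle j : normc (angle j) = 1.
Proof. exact: normc_turn. Qed.

Lemma angle_neq0 j : angle j != 0.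
Proof. exact: turn_neq0. Qed.

Lemma angle_inj : injective angle.
Proof.
suff H (i j : 'I_N) : (i < j)%N -> angle i <> angle j.
  move=> i j E; have [/H|/H|/val_inj//] := ltngtP i j; [by []|].
  by move=> /(_ (esym E)).
move=> ij E; have : turn (j%:R / N%:R - i%:R / N%:R : R) != 1.
  apply: turn_neq1; rewrite -mulrBl -natrB ?(ltnW ij)//.
  rewrite divr_gt0 ?ltr0n ?subn_gt0//= ltr_pdivrMr ?ltr0n// mul1r ltr_nat.
  by rewrite (leq_ltn_trans (leq_subr _ _)).
apply/negP; rewrite negbK; apply/eqP.
apply: (mulIf (angle_neq0 i)); rewrite mul1r [in RHS]E.
by rewrite /angle -turnD subrK.
Qed.

Definition rotated_costara (j : 'I_N) S : C := angle j ^- k.-1 * costara (angle j) S.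

Definition costara_average S : C := N%:R^-1 * \sum_(j < N) rotated_costara j S.

(** The factor [angle j ^- k.-1] cancels the dependence on [j]. *)
Lemma diff_rotated_costara j : (k <= n)%N ->
  'd (rotated_costara j) 0 (e R n k) = k%:R / n%:R.
Proof.
move=> kn; have dc : differentiable (costara (angle j) : V -> C) 0.
  by apply: differentiable_costara; rewrite costara_den0 pnatr_eq0 -lt0n.
have -> : rotated_costara j = (angle j ^- k.-1) *: (costara (angle j) : V -> C) by [].
rewrite diffZ// -[LHS]/(_ * 'd (costara (angle j)) 0 (e R n k)).
rewrite diff_costara0// costara_num_e ?k_gt0//.
rewrite mulrCA [k%:R * _]mulrC mulKf ?expf_neq0 ?angle_neq0//.
by rewrite mulrC.
Qed.

(** At such angles, [costara (angle j)] has no pole at [sigma z], even if [z]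
    lies on the boundary of the polydisc. *)
Definition regular z (j : 'I_N) := [forall i, 1 + angle j * z 0 i != 0].

Lemma regularP z j : reflect (forall i, 1 + angle j * z 0 i != 0) (regular z j).
Proof. exact: forallP. Qed.

(** A coordinate [z 0 i] spoils at most the one angle [- 1 / z 0 i]. *)
Lemma card_regular z : (N - n <= #|[set j | regular z j]%SET|)%N.
Proof.
set A := [set j | regular z j]%SET.
suff : (#|~: A| <= n)%N by rewrite cardsCs finset.setCK card_ord; lia.
pose f j : 'I_n := if [pick i | 1 + angle j * z 0 i == 0] is Some i then i else Ordinal n_gt0.
have finj : {in ~: A &, injective f}.
  move=> j j'; rewrite !inE !negb_forall => /existsP[i hi] /existsP[i' hi'].
  rewrite /f; case: pickP => [x /eqP xE|/(_ i)]; last by move: hi; rewrite negbK => ->.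
  case: pickP => [x' /eqP xE'|/(_ i')]; last by move: hi'; rewrite negbK => ->.
  move=> xx'; apply: angle_inj; rewrite -xx' in xE'.
  have zx0 : z 0 x != 0.
    by apply: contra_eqN xE => /eqP ->; rewrite mulr0 addr0 oner_neq0.
  by apply: (mulIf zx0); apply: (addrI 1); rewrite xE xE'.
by rewrite -(card_in_imset finj) -[leqRHS]card_ord max_card.
Qed.

Lemma rotated_costara_le1 z j : (forall i, normc (z 0 i) <= 1) -> regular z j ->
  normc (rotated_costara j (sigma z)) <= 1.
Proof.
move=> z1 /regularP zj; rewrite normcM normcV normcX normc_angle expr1n invr1 mul1r.
exact: costara_le1 (normc_angle j) zj n_gt0 z1.
Qed.

(** If all pairs of regular terms added up to modulus 2, the regular terms would
    share a unimodular value, and there are enough of them for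
    [costara_constant_dvd]. *)
Lemma rotated_costara_pair z : ~~ (k %| n)%N -> (n + (n + k) < N)%N ->
    (forall i, normc (z 0 i) <= 1) ->
  exists i j, [/\ regular z i, regular z j &
    normc (rotated_costara i (sigma z) + rotated_costara j (sigma z)) < 2].
Proof.
move=> kn Nbig z1; apply: contrapT => nopair.
have big i j : regular z i -> regular z j ->
    2 <= normc (rotated_costara i (sigma z) + rotated_costara j (sigma z)).
  by move=> ri rj; rewrite leNgt; apply/negP => lt2; apply: nopair; exists i, j.
set A := [set j | regular z j]%SET.
have cA : (n + k < #|A|)%N by apply: leq_trans (card_regular z); lia.
have /card_gt0P[j0] : (0 < #|A|)%N by lia.
rewrite inE => r0; pose c := rotated_costara j0 (sigma z).
have c0 : c != 0.
  apply: contraTneq (big _ _ r0 r0) => c0.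
  by rewrite -/c c0 addr0 normc0 -ltNge.
have cE j : regular z j -> rotated_costara j (sigma z) = c.
  by move=> rj; apply: normc_add_eq2; rewrite ?rotated_costara_le1// big.
move/negP: kn; apply; apply: (@costara_constant_dvd (sigma z) k c (map angle (enum A))) => //.
- by rewrite map_inj_uniq ?enum_uniq//; exact: angle_inj.
- by rewrite size_map -cardE.
move=> _ /mapP[j + ->]; rewrite mem_enum inE => rj.
have den0 : costara_den (angle j) (sigma z) != 0.
  by apply: costara_den_neq0 (normc_angle j) _ n_gt0 z1; apply/regularP.
rewrite -(cE j rj) /rotated_costara /costara; field.
by rewrite den0 expf_neq0// angle_neq0.
Qed.

End Average.

Lemma differentiable_sigma z : differentiable (@sigma R n) z.
Proof.
have -> : @sigma R n = \sum_(m < n) (fun z : V =>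
    (\sum_(A : {set 'I_n} | #|A| == m.+1) \prod_(j in A) z 0 j) *: e R n m.+1).
  apply/funext => w; rewrite fct_sumE; apply/rowP => m.
  rewrite summxE mxE (bigD1 m)//= [X in _ = _ + X]big1 => [|i im].
    by rewrite addr0 !mxE eqxx mulr1.
  by rewrite !mxE eqSS eq_sym val_eqE (negPf im) mulr0.
apply: differentiable_sum => m; apply: differentiableZl.
have -> : (fun z : V => \sum_(A : {set 'I_n} | #|A| == m.+1) \prod_(j in A) z 0 j) =
    \sum_(A : {set 'I_n} | #|A| == m.+1) (fun z : V => \prod_(j in A) z 0 j).
  by apply/funext => w; rewrite fct_sumE.
apply: (big_ind (fun f : V -> C => differentiable f z)) => [|f g|A _].
- exact: (differentiable_cst (0 : C)).
- exact: differentiableD.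
have -> : (fun z : V => \prod_(j in A) z 0 j) = \prod_(j in A) (fun z : V => z 0 j).
  by apply/funext => w; rewrite fct_prodE.
apply: (big_ind (fun f : V -> C => differentiable f z)) => [|f g|j _].
- exact: (differentiable_cst (1 : C)).
- exact: differentiableM.
- exact: differentiable_coord.
Qed.

(** A closed subset of a square, the latter being the image of a product of real
    segments. *)
Lemma compact_closed_disc : compact [set x : C | normc x <= 1].
Proof.
pose square := (fun p : R * R => (p.1 +i* p.2)%C) @` (`[-1, 1] `*` `[-1, 1]).
apply: (@subclosed_compact _ _ square).
- rewrite -[X in closed X]setCK; apply: open_closedC; rewrite openE => x /= /negP.
  rewrite -ltNge => x1; apply/nbhs_normcP; exists (normc x - 1); first by rewrite subr_gt0.
  move=> y yx /= y1; have : normc x <= normc (y - x) + normc y.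
    by rewrite normcC -{1}(subrK y x) normcD_le.
  by lra.
- apply: continuous_compact.
    apply: continuous_subspaceT => p A /nbhs_normcP[d d0 dA].
    apply/nbhs_ballP; exists (d / 2) => /=; first by rewrite divr_gt0.
    move=> q [/= q1 q2]; apply: dA.
    have -> : ((q.1 +i* q.2) - (p.1 +i* p.2))%C =
        ((q.1 - p.1)%:C + (q.2 - p.2)%:C * 'i)%C by simpc.
    apply: (le_lt_trans (normcD_le _ _)); rewrite normcM !normc_real.
    rewrite (_ : normc 'i%C = 1) ?mulr1; last first.
      by rewrite /normc expr0n expr1n add0r sqrtr1.
    move: q1 q2; rewrite /ball/= distrC => q1; rewrite distrC => q2.
    by lra.
  by apply: compact_setX; exact: segment_compact.
- move=> [a b] /= ab; have : a ^+ 2 + b ^+ 2 <= 1.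
    by move: ab; rewrite -{1}sqrtr1 ler_sqrt.
  move=> ab1; have a2 : a ^+ 2 <= 1 by have := sqr_ge0 b; lra.
  have b2 : b ^+ 2 <= 1 by have := sqr_ge0 a; lra.
  exists (a, b) => //; split => /=; rewrite in_itv/= -ler_norml;
    by rewrite -(@ler_pXn2r _ 2)// ?nnegrE// real_normK ?num_real// expr1n.
Qed.

Lemma compact_closed_polydisc : compact [set z : V | forall i, normc (z 0 i) <= 1].
Proof.
exact: (@rV_compact C n (fun=> [set x : C | normc x <= 1])
  (fun=> compact_closed_disc)).
Qed.

Section AverageBound.
Variables (k : nat) (N : nat).
Hypotheses (k_gt0 : (0 < k)%N) (N_gt0 : (0 < N)%N).
Hypotheses (kn : ~~ (k %| n)%N) (Nbig : (n + (n + k) < N)%N).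
Local Notation b := (rotated_costara k).

(** The average itself need not extend continuously to the closed polydisc;
    only the pair of [rotated_costara_pair] is used near [z], the other terms
    being bounded by 1. *)
Lemma costara_average_local z : (forall i, normc (z 0 i) <= 1) ->
  exists2 d : R, 0 < d & \forall w \near z, polydisc w ->
    normc (costara_average k N (sigma w)) <= 1 - d.
Proof.
move=> z1; have [i [j [ri rj lt2]]] := rotated_costara_pair k_gt0 N_gt0 kn Nbig z1.
pose s w := b i (sigma w) + b j (sigma w).
pose h := 2 - normc (s z).
have h0 : 0 < h by rewrite subr_gt0.
have cs : s w @[w --> z] --> s z.
  have ds (l : 'I_N) : regular z l -> differentiable (fun w => b l (sigma w)) z.
    move=> /regularP rl; apply: differentiableM.
      exact: (differentiable_cst ((angle l) ^- k.-1)).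
    apply: (differentiable_comp (differentiable_sigma z)).
    apply: differentiable_costara.
    exact: costara_den_neq0 (normc_angle l) rl n_gt0 z1.
  have dss : differentiable s z := differentiableD (ds _ ri) (ds _ rj).
  exact: differentiable_continuous dss.
have N2 : 0 < 2 * (N%:R : R) ^+ 2 by rewrite mulr_gt0// exprn_gt0// ltr0n.
exists (h / 2 / (2 * N%:R ^+ 2)); first by rewrite !divr_gt0.
have /cvg_normcP/(_ (h / 2)) := cs; rewrite divr_gt0// => /(_ isT).
apply: filterS => w sw Dw.
have sw2 : normc (s w) <= 2 - h / 2.
  have -> : s w = (s w - s z) + s z by rewrite subrK.
  by apply: (le_trans (normcD_le _ _)); rewrite /h in sw *; lra.
have b1 (l : 'I_N) : normc (b l (sigma w)) <= 1.
  apply: rotated_costara_le1 => [m|]; first by apply/ltW/Dw.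
  apply/regularP => m; apply: one_add_neq0; [exact: normc_angle|exact: Dw].
exact: (normc_mean_pair b1 sw2).
Qed.

Lemma costara_average_bound : exists2 d : R, 0 < d <= 1 &
  forall w : V, polydisc w -> normc (costara_average k N (sigma w)) <= 1 - d.
Proof.
have /compact_near_coveringP/(_ R (0^'+)) :=  compact_closed_polydisc.
move=> /(_ (fun d w => polydisc w ->
   normc (costara_average k N (sigma w)) <= 1 - d) _).
case=> [z z1|].
  have [d d0 zd] := costara_average_local z1.
  exists ([set w | polydisc w -> normc (costara_average k N (sigma w)) <= 1 - d],
      [set x : R | x < d]).
    split=> //=; exact: nbhs_right_lt.
  move=> [w x] [/= hw xd] /hw /le_trans; apply.
  by rewrite lerD2l lerN2 ltW.
move=> d0 /= d0_gt0 d0P; pose d := Num.min 1 (d0 / 2).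
have d_gt0 : 0 < d by rewrite lt_min ltr01 divr_gt0.
have d1 : d <= 1 by rewrite ge_min lexx.
have dd0 : d <= d0 / 2 by rewrite ge_min lexx orbT.
exists d; first by rewrite d_gt0.
move=> w Dw; apply: (d0P d) => //.
- by rewrite /= sub0r normrN gtr0_norm//; lra.
- by move=> i; apply/ltW/Dw.
Qed.

End AverageBound.

Lemma differentiable_rotated_costara k N (j : 'I_N) (S : V) :
  costara_den (angle j) S != 0 -> differentiable (rotated_costara k j) S.
Proof.
move=> d0; apply: differentiableM; last exact: differentiable_costara.
exact: (differentiable_cst (angle j ^- k.-1)).
Qed.

Lemma rho_lt_caratheodory_e k : (1 <= k <= n)%N -> ~~ (k %| n)%N ->
  ((rho (e R n k))%:E < caratheodory G 0 (e R n k))%E.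
Proof.
move=> /andP[k0 kn] kNn; pose N := (n + (n + k)).+1.
have [d /andP[d0 d1] dP] := costara_average_bound k0 (ltn0Sn _) kNn (ltnSn (n + (n + k))).
rewrite -/N in dP.
(* Dividing by [1 - d] would only give values in the closed disc. *)
pose c : C := ((1 - d / 2)%:C)%C.
have c_gt0 : 0 < 1 - d / 2 by lra.
have nc : normc c = 1 - d / 2 by rewrite normc_real gtr0_norm.
have c0 : c != 0 by rewrite -normc_gt0 nc.
have cnt0 : (0 < k%:R / n%:R :> R) by rewrite divr_gt0 ?ltr0n.
pose A : V -> C := \sum_(j < N) rotated_costara k j.
pose f : V -> C := (c^-1 * N%:R^-1) *: A.
have fE S : f S = c^-1 * costara_average k N S.
  by rewrite /f /A -[LHS]/(_ * (\sum_(j < N) rotated_costara k j) S) fct_sumE mulrA.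
have dA S : G S -> differentiable A S.
  case=> z Dz <-; apply: differentiable_sum => j.
  apply: differentiable_rotated_costara.
  apply: costara_den_neq0 (normc_angle j) _ n_gt0 _ => i; last exact/ltW/Dz.
  by apply: one_add_neq0; [exact: normc_angle | exact: Dz].
have G0 : G 0.
  exists 0 => [j|]; first by rewrite mxE; exact: unit_disc0.
  apply/rowP => j; rewrite !mxE big1// => J /eqP cJ.
  have [i iJ] : exists i, i \in J by apply/card_gt0P; rewrite cJ.
  by rewrite (bigD1 i)//= mxE mul0r.
have df S : G S -> differentiable f S by move=> GS; apply: differentiableZ; exact: dA.
apply: (@lt_le_trans _ _ ((1 - d / 2)^-1 * (k%:R / n%:R))%:E).
  rewrite lte_fin rho_e ?k0// ltr_pMl// invf_gt1//; lra.
apply: ereal_sup_ubound; exists f.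
  split=> [S GS|]; last first.
    rewrite fE /costara_average big1 ?mulr0// => j _.
    by rewrite /rotated_costara /costara costara_num0 mul0r mulr0.
  split; first exact: df.
  case: GS => z Dz <-; apply/unit_discP; rewrite fE normcM normcV nc.
  rewrite ltr_pdivrMl// mulr1; apply: (le_lt_trans (dP _ Dz)); lra.
have dr (j : 'I_N) : differentiable (rotated_costara k j : V -> C) 0.
  by apply: differentiable_rotated_costara; rewrite costara_den0 pnatr_eq0 -lt0n.
have -> : 'd f 0 (e R n k) = c^-1 * (k%:R / n%:R).
  rewrite (diffZ _ (dA _ G0)) -[LHS]/(_ * 'd A 0 (e R n k)).
  rewrite -(deriveE _ (dA _ G0)) derive_sum => [|j]; last exact: diff_derivable.
  under eq_bigr => j _ do rewrite deriveE// diff_rotated_costara//.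
  rewrite sumr_const card_ord -[(k%:R / n%:R) *+ _]mulr_natl -mulrA mulKf//.
  by rewrite pnatr_eq0.
by rewrite !normcM !normcV nc !normc_nat.
Qed.

End NonDivisibleCase.

(** * The plane spanned by [e_1] and [e_n] *)

Section StrictInequality.
Variables (R : realType) (m : nat).
Hypothesis m_ge2 : (2 <= m)%N.
Local Notation n := m.+1.
Local Notation C := R[i].
Local Notation V := 'rV[C]_n.
Local Notation G := (symmetrized_polydisc R n).
Implicit Types (S X : V) (t : C).

(** Dividing by the node shifts frequencies by one: among [0, ..., m] only the
    frequency 1 survives summation over a coset of the [m]-th roots of unity.
    The sign in [weight] removes it. *)
Lemma sum_pow_coset (x : C) (f : nat) : x != 0 -> (f <= m)%N ->
  \sum_(i < m) (x * turn (i%:R / m%:R)) ^+ f / (x * turn (i%:R / m%:R))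
  = (f == 1)%N%:R * m%:R.
Proof.
move=> x0 fm; have m0 : (m%:R : R) != 0 by rewrite pnatr_eq0; lia.
have turnE (u : R) (i : nat) : turn (i%:R / m%:R) = (turn (m%:R^-1 : R)) ^+ i.
  by rewrite turnX.
have eta_m : (turn (m%:R^-1 : R)) ^+ m = 1 by rewrite turnX divff// turn1.
have eta_n1 j : (0 < j < m)%N -> (turn (m%:R^-1 : R)) ^+ j != 1.
  case/andP => j0 jm; rewrite turnX; apply: turn_neq1.
  by rewrite divr_gt0 ?ltr0n//= ?ltr_pdivrMr ?ltr0n ?mul1r ?ltr_nat//; lia.
set eta := turn m%:R^-1 in eta_m eta_n1 turnE.
have eta0 : eta != 0 by apply: turn_neq0.
case: f fm => [|f] fm.
  rewrite mul0r.
  have -> : \sum_(i < m) (x * turn (i%:R / m%:R)) ^+ 0 / (x * turn (i%:R / m%:R)) =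
      x^-1 * \sum_(i < m) (eta^-1) ^+ i.
    by rewrite mulr_sumr; apply: eq_bigr => i _; rewrite expr0 div1r invfM (turnE 0) exprVn.
  rewrite sum_root_of_unity ?mulr0//; first by rewrite exprVn eta_m invr1.
  by rewrite invr_eq1; have := eta_n1 1%N; rewrite expr1; apply; lia.
have -> : \sum_(i < m) (x * turn (i%:R / m%:R)) ^+ f.+1 / (x * turn (i%:R / m%:R)) =
    x ^+ f * \sum_(i < m) (eta ^+ f) ^+ i.
  rewrite mulr_sumr; apply: eq_bigr => i _; rewrite (turnE 0) exprSr mulfK.
    by rewrite exprMn -!exprM mulnC.
  by rewrite mulf_neq0// expf_neq0.
case: f fm => [|f] fm.
  by rewrite !expr0 eqxx !mul1r; under eq_bigr do rewrite expr1n; rewrite sumr_const card_ord.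
rewrite [(_ == _)](_ : _ = false)// mul0r sum_root_of_unity ?mulr0//.
  by rewrite -exprM mulnC exprM eta_m expr1n.
by apply: eta_n1; lia.
Qed.

Lemma sum_pow_coset_top (x : C) : x != 0 ->
  \sum_(i < m) (x * turn (i%:R / m%:R)) ^+ n / (x * turn (i%:R / m%:R)) = x ^+ m * m%:R.
Proof.
move=> x0; have m0 : (m%:R : R) != 0 by rewrite pnatr_eq0; lia.
have -> : x ^+ m * m%:R = \sum_(i < m) x ^+ m by rewrite sumr_const card_ord mulr_natr.
apply: eq_bigr => i _; rewrite exprSr mulfK.
  by rewrite exprMn turnX [m%:R * _]mulrC divfK// -[i%:R]mulr1 -turnX turn1 expr1n mulr1.
by rewrite mulf_neq0// turn_neq0.
Qed.

Section Nodes.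
Variables (x y : C).
Hypotheses (x1 : normc x = 1) (y1 : normc y = 1).

(** The nodes run through two cosets of the [m]-th roots of unity. The weights
    annihilate all frequencies up to [m], but not the frequency [m + 1] if
    [x ^+ m] and [y ^+ m] differ. *)
Definition node (p : 'I_m * bool) : C :=
  (if p.2 then x else y) * turn (p.1%:R / m%:R).

Definition weight (p : 'I_m * bool) : C := (-1) ^+ (~~ p.2) / node p.

Lemma normc_node p : normc (node p) = 1.
Proof. by rewrite /node normcM normc_turn mulr1; case: p.2. Qed.

Lemma normc_weight p : normc (weight p) = 1.
Proof.
rewrite /weight normcM normcV normc_node invr1 mulr1 normcX normcNE normc1.
exact: expr1n.
Qed.

Let x0 : x != 0. Proof. by rewrite -normc_gt0 x1. Qed.
Let y0 : y != 0. Proof. by rewrite -normc_gt0 y1. Qed.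

Lemma sum_weight f : \sum_p weight p * node p ^+ f =
  \sum_(i < m) (x * turn (i%:R / m%:R)) ^+ f / (x * turn (i%:R / m%:R))
  - \sum_(i < m) (y * turn (i%:R / m%:R)) ^+ f / (y * turn (i%:R / m%:R)).
Proof.
rewrite -(pair_bigA _ (fun (i : 'I_m) (b : bool) => weight (i, b) * node (i, b) ^+ f))/=.
rewrite -sumrB; apply: eq_bigr => i _; rewrite big_bool /weight /node/= expr0 expr1.
by rewrite mul1r mulN1r mulNr ![_^-1 * _]mulrC.
Qed.

Lemma sum_weight_low f : (f <= m)%N -> \sum_p weight p * node p ^+ f = 0.
Proof. by move=> fm; rewrite sum_weight !sum_pow_coset// subrr. Qed.

Lemma sum_weight_top :
  \sum_p weight p * node p ^+ n = m%:R * (x ^+ m - y ^+ m).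
Proof. by rewrite sum_weight !sum_pow_coset_top// -mulrBl mulrC. Qed.

Lemma sum_weight_costara_num S : \sum_p weight p * costara_num (node p) S = 0.
Proof.
rewrite /costara_num; under eq_bigr do rewrite mulr_sumr.
rewrite exchange_big big1//= => j _.
under eq_bigr do rewrite mulrCA.
by rewrite -mulr_sumr sum_weight_low ?mulr0// -ltnS.
Qed.

End Nodes.

Lemma costara_den_scale t S (z : C) :
  costara_den t (z *: S) - n%:R = z * (costara_den t S - n%:R).
Proof.
rewrite /costara_den ![n%:R + _]addrC !addrK mulr_sumr.
by apply: eq_bigr => j _; rewrite mxE; ring.
Qed.

Lemma costara_den_e1n t (a b : C) :
  costara_den t (a *: e R n 1 + b *: e R n n) - n%:R = m%:R * a * t.
Proof.
rewrite /costara_den [n%:R + _]addrC addrK big_ord_recl/= big1 ?addr0 => [|j _].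
  have m0 : (0 == m)%N = false by lia.
  by rewrite !mxE/= eqSS m0 mulr1 mulr0 addr0 subn1 expr1.
rewrite !mxE lift0 eqSS [X in a * X](_ : _ = 0) ?mulr0 ?add0r//.
have [->|jm] := eqVneq j.+2 n; first by rewrite subnn !mul0r.
by rewrite mulr0 mulr0 mul0r.
Qed.

Lemma symmetrized_polydisc_den_neq0 t S : normc t = 1 -> G S -> costara_den t S != 0.
Proof.
move=> t1 [z Dz <-]; apply: (costara_den_neq0 t1) => // i; last exact/ltW/Dz.
by apply: one_add_neq0 => //; exact: Dz.
Qed.

(** Along a disc through the origin, the combination of Costara functions
    over the nodes has no first-order term; its second-order term is the
    product of the linear parts of numerator and denominator. *)
Lemma combination_cvg (x y : C) (g : C -> V) (X : V) :
    normc x = 1 -> normc y = 1 -> holomorphic_map (unit_disc R) G g -> g 0 = 0 ->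
    derive1 g 0 = X ->
  (\sum_p weight x y p * costara (node x y p) (g z)) / z ^+ 2 @[z --> 0^'] -->
  - (n%:R ^- 2) * \sum_p weight x y p *
      (costara_num (node x y p) X * (costara_den (node x y p) X - n%:R)).
Proof.
move=> x1 y1 hg g0 gX; set w := weight x y; set t := node x y.
have n0 : (n%:R : C) != 0 by rewrite pnatr_eq0.
have [dg _] := hg 0 (unit_disc0 R).
have cq : z^-1 *: g z @[z --> 0^'] --> X by rewrite -gX; exact: cvg_divid.
have cg : g z @[z --> 0^'] --> (0 : V).
  have : g z @[z --> (0 : C)] --> g 0 by exact: differentiable_continuous dg.
  by rewrite g0; apply: cvg_trans; apply: cvg_within_filter.
have cnum p : costara_num (t p) (z^-1 *: g z) @[z --> 0^'] --> costara_num (t p) X.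
  apply: (cvg_comp _ _ cq).
  exact: differentiable_continuous (differentiable_costara_num _ _).
have cden p : costara_den (t p) (z^-1 *: g z) @[z --> 0^'] --> costara_den (t p) X.
  apply: (cvg_comp _ _ cq).
  exact: differentiable_continuous (differentiable_costara_den _ _).
have cden0 p : costara_den (t p) (g z) @[z --> 0^'] --> (n%:R : C).
  rewrite -(costara_den0 n (t p)).
  apply: (cvg_comp _ _ cg).
  exact: differentiable_continuous (differentiable_costara_den _ _).
rewrite mulr_sumr.
have main p : - (w p * (costara_num (t p) (z^-1 *: g z) *
      (costara_den (t p) (z^-1 *: g z) - n%:R)) / (n%:R * costara_den (t p) (g z)))
    @[z --> 0^'] --> - (n%:R ^- 2) *
      (w p * (costara_num (t p) X * (costara_den (t p) X - n%:R))).
  rewrite [X in _ --> X](_ : _ = - (w p * (costara_num (t p) X * (costara_den (t p) X - n%:R))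
     / (n%:R * n%:R))); last by field.
  apply: cvgN; apply: cvgM; last first.
    apply: cvgV; first by rewrite mulf_neq0.
    by apply: cvgM; [exact: cvg_cst | exact: cden0].
  apply: cvgM; first exact: cvg_cst.
  apply: cvgM; first exact: cnum.
  by apply: cvgB; [exact: cden | exact: cvg_cst].
have main_sum : \sum_p - (w p * (costara_num (t p) (z^-1 *: g z) *
      (costara_den (t p) (z^-1 *: g z) - n%:R)) / (n%:R * costara_den (t p) (g z)))
    @[z --> 0^'] --> \sum_p - (n%:R ^- 2) *
      (w p * (costara_num (t p) X * (costara_den (t p) X - n%:R))).
  by apply: cvg_big => [|p _]; [exact: add_continuous | exact: main].
apply: cvg_trans main_sum; apply: near_eq_cvg; near=> z.
have z0 : z != 0 by near: z; exact: nbhs_dnbhs_neq.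
have Dz : unit_disc R z.
  near: z; apply/dnbhs0_normcP; exists 1 => // z _ z1; exact/unit_discP.
have Gz := (hg z Dz).2.
have -> : \sum_p w p * costara (t p) (g z) =
    \sum_p w p * (costara (t p) (g z) - n%:R^-1 * costara_num (t p) (g z)).
  under [RHS]eq_bigr do rewrite mulrBr.
  rewrite sumrB [X in _ - X](_ : _ = 0) ?subr0//.
  under eq_bigr do rewrite mulrCA.
  by rewrite -mulr_sumr sum_weight_costara_num ?mulr0.
rewrite mulr_suml; apply: eq_bigr => p _.
have d0 : costara_den (t p) (g z) != 0.
  by apply: symmetrized_polydisc_den_neq0 Gz; exact: normc_node.
have numZ : costara_num (t p) (z^-1 *: g z) = z^-1 * costara_num (t p) (g z) by exact: linearZ.
rewrite costara_den_scale numZ /costara.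
by move: n0; move: (n%:R : C) => k k0; field; rewrite ?z0 ?d0 ?k0.
Unshelve. all: by end_near.
Qed.

(** If [A] were close to [r = p + q], the right-hand side of the hypothesis
    would be close to [4 k (r^2 - s r) / r^2], which is less than
    [k p q / r^2], whereas the left-hand side exceeds [2 k p q / r^2]. *)
Lemma gap_estimate (k p q A s : R) : 2 <= k -> 0 < p -> 0 < q -> 0 < A -> 0 <= s ->
    s ^+ 2 = p ^+ 2 + q ^+ 2 + 8 / 5 * p * q ->
    k ^+ 2 * (p * q / A ^+ 2) * (6 / 5) <= k * 2 * (2 * (1 - s / A)) ->
  p + q + p * q / (10 * (p + q)) <= A.
Proof.
move=> k2 p0 q0 A0 s0 s2 main.
pose r := p + q; have r0 : 0 < r by rewrite addr_gt0.
pose u := p * q / (10 * r).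
have u0 : 0 < u by rewrite divr_gt0 ?mulr_gt0.
have pqE : p * q = 10 * (r * u) by rewrite /u; field; rewrite gt_eqF.
have pq0 : 0 < p * q by rewrite mulr_gt0.
have u_le : 40 * u <= r.
  rewrite -(ler_pM2l r0); have : 0 <= (p - q) ^+ 2 by rewrite sqr_ge0.
  have : r * r = p ^+ 2 + q ^+ 2 + 2 * (p * q) by rewrite /r; ring.
  have : (p - q) ^+ 2 = p ^+ 2 + q ^+ 2 - 2 * (p * q) by ring.
  by move: pqE; move: (p * q) (_ ^+ 2) (p ^+ 2) (q ^+ 2) => *; lra.
have main2 : 6 * (r * u) <= A * (A - s).
  have e1 : k ^+ 2 * (p * q / A ^+ 2) * (6 / 5) = (k / A ^+ 2) * (k * (p * q) * (6 / 5)).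
    by ring.
  have e2 : k * 2 * (2 * (1 - s / A)) = (k / A ^+ 2) * (4 * (A * (A - s))).
    by field; rewrite gt_eqF.
  move: main; rewrite e1 e2 ler_pM2l; last by rewrite divr_gt0 ?exprn_gt0//; lra.
  have : 2 * (p * q) <= k * (p * q) by rewrite ler_pM2r.
  by rewrite pqE; lra.
rewrite -/r -/u leNgt; apply/negP => Aru.
have s_ge : r - 5 / 2 * u <= s.
  rewrite leNgt; apply/negP => s_lt.
  have : s ^+ 2 < (r - 5 / 2 * u) ^+ 2 by rewrite ltr_pXn2r// nnegrE//; lra.
  have -> : s ^+ 2 = r ^+ 2 - 4 * (r * u).
    rewrite s2; have -> : 4 * (r * u) = 2 / 5 * (p * q) by rewrite pqE; field.
    by rewrite /r; field.
  have -> : (r - 5 / 2 * u) ^+ 2 = r ^+ 2 - 5 * (r * u) + 25 / 4 * (u * u) by field.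
  have : 40 * (u * u) <= r * u by rewrite mulrA ler_pM2r.
  have : 0 < r * u by rewrite mulr_gt0.
  by move: (r * u) (u * u) (r ^+ 2) => *; lra.
have As : A * (A - s) <= A * (7 / 2 * u) by rewrite ler_pM2l//; lra.
have Au : A * (7 / 2 * u) <= (r + u) * (7 / 2 * u).
  by rewrite ler_pM2r; [exact: ltW | lra].
have ruu : 40 * (u * u) <= r * u by rewrite mulrA ler_pM2r.
have ru0 : 0 < r * u by rewrite mulr_gt0.
by move: main2 As Au ruu ru0; move: (A * (A - s)) (A * _) (r * u) (u * u)
  (mulrDl r u (7 / 2 * u)) (mulrCA r (7 / 2) u) (mulrCA u (7 / 2) u) => *; lra.
Qed.

Lemma kobayashi_gap (a b : C) (p q : R) : a != 0 -> b != 0 ->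
    p = normc a / n%:R -> q = normc b ->
  ((p + q + p * q / (10 * (p + q)))%:E
     <= kobayashi G 0 (a *: e R n 1 + b *: e R n n))%E.
Proof.
move=> a0 b0 pE qE; apply: le_ereal_inf_tmp => _ [al [g [hg g0 gX]] <-].
have n0 : (n%:R : C) != 0 by rewrite pnatr_eq0.
have nR0 : 0 < (n%:R : R) by rewrite ltr0n.
have m1n : (1 <= 1 <= n)%N by [].
have nnn : (1 <= n <= n)%N by rewrite leqnn.
have al0 : al != 0.
  apply: contraNneq a0 => al0; have /rowP/(_ ord0) := gX.
  rewrite al0 scale0r !mxE/= eqSS [(0 == m)%N](_ : _ = false); last by lia.
  by rewrite mulr1 mulr0 addr0 => <-.
have gX' : derive1 g 0 = (al^-1 * a) *: e R n 1 + (al^-1 * b) *: e R n n.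
  by rewrite -!scalerA -scalerDr -gX scalerK.
(* Rational points of the circle at a small angle [th] from 1: the sum over the
   nodes is of order [sin th], the defects [1 - |c_1|] of order [1 - cos th]. *)
pose w : C := Complex (4 / 5) (3 / 5); pose w' : C := Complex (4 / 5) (- (3 / 5)).
have sq1 : (4 / 5) ^+ 2 + (3 / 5) ^+ 2 = 1 :> R by field.
have w1 : normc w = 1 by rewrite /normc/= sq1 sqrtr1.
have w'1 : normc w' = 1 by rewrite /normc/= sqrrN sq1 sqrtr1.
have [v [d [v1 d1 aE bE]]] := align_direction a (n%:R * b).
have m_gt0 : (0 < m)%N by lia.
have [x x1 xm] : exists2 x : C, normc x = 1 & x ^+ m = v * w.
  by apply: unimodular_root => //; rewrite normcM v1 w1 mulr1.
have [y y1 ym] : exists2 y : C, normc y = 1 & y ^+ m = v * w'.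
  by apply: unimodular_root => //; rewrite normcM v1 w'1 mulr1.
(* The common value of [|al c_1|] at all nodes. *)
pose s := Num.sqrt ((p + q * (4 / 5)) ^+ 2 + (q * (3 / 5)) ^+ 2).
have nodeX r : node x y r ^+ m = v * (if r.2 then w else w').
  rewrite /node exprMn turnX mulrC -[m%:R * _]mulrC divfK ?pnatr_eq0 -?lt0n//.
  rewrite -[_%:R]mulr1 -turnX turn1 expr1n mul1r.
  by case: r.2; rewrite ?xm ?ym.
have numX r : costara_num (node x y r) (derive1 g 0) =
    al^-1 * (a + n%:R * b * node x y r ^+ m).
  rewrite gX' linearD !linearZ/= !costara_num_e// -![_ *: _]/(_ * _)/= expr0 mulr1.
  by ring.
have normX r : normc (n%:R^-1 * costara_num (node x y r) (derive1 g 0)) = s / normc al.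
  rewrite numX nodeX.
  have -> : a + n%:R * b * (v * (if r.2 then w else w')) =
      d * (((normc a)%:C)%C + ((normc (n%:R * b))%:C)%C * (if r.2 then w else w')).
    by rewrite mulrDr -aE [d * (_ * _)]mulrA -bE; congr (_ + _); ring.
  rewrite normcM [normc (_^-1 * _)]normcM [normc (d * _)]normcM !normcV d1 mul1r.
  rewrite (normc_nat R n).
  have -> : normc (((normc a)%:C)%C + ((normc (n%:R * b))%:C)%C
      * (if r.2 then w else w')) = n%:R * s.
    rewrite normcM (normc_nat R n) -qE.
    have -> : normc a = n%:R * p by rewrite pE mulrC divfK// gt_eqF.
    rewrite -[n%:R in RHS]ger0_norm// -sqrtr_sqr /s -sqrtrM ?sqr_ge0//.
    case: r.2; rewrite /w /w'; simpc; rewrite /normc; congr (Num.sqrt _); ring.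
  by rewrite mulrCA mulKf ?gt_eqF// mulrC.
have main := combination_cvg x1 y1 hg g0 (erefl _).
have hol r : holomorphic_map (unit_disc R) (unit_disc R) (costara (node x y r) \o g).
  apply: holomorphic_comp hg; apply: costara_holomorphic => //; exact: normc_node.
have h0 r : (costara (node x y r) \o g) 0 = 0.
  by rewrite /= g0 /costara costara_num0 mul0r.
have := schwarz_second hol h0 main.
have dh r : derive1 (costara (node x y r) \o g) 0 =
    n%:R^-1 * costara_num (node x y r) (derive1 g 0).
  have [dg Gg] := hg 0 (unit_disc0 R).
  have df : differentiable (costara (node x y r)) (g 0).
    by apply: differentiable_costara; rewrite g0 costara_den0.
  by rewrite (derive1_comp_diff dg df) g0 diff_costara0.
under [leRHS]eq_bigr do rewrite dh normX normc_weight// mul1r.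
rewrite sumr_const card_prod card_ord card_bool -[X in _ <= X -> _]mulr_natl natrM.
have -> : \sum_r weight x y r * (costara_num (node x y r) (derive1 g 0) *
      (costara_den (node x y r) (derive1 g 0) - n%:R)) =
    m%:R * (al^-1 * a) * (n%:R * (al^-1 * b)) * (m%:R * (v * (w - w'))).
  rewrite mulrBr -xm -ym -(sum_weight_top x1 y1).
  have low1 : \sum_r weight x y r * node x y r ^+ 1 = 0.
    by apply: sum_weight_low => //; lia.
  transitivity (m%:R * (al^-1 * a) * (n%:R * (al^-1 * b)) *
      (\sum_r weight x y r * node x y r ^+ n)
    + m%:R * (al^-1 * a) * (al^-1 * a) * (\sum_r weight x y r * node x y r ^+ 1)).
    2: by rewrite low1 mulr0 addr0.
  rewrite !mulr_sumr -big_split/=; apply: eq_bigr => r _.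
  rewrite numX gX' costara_den_e1n expr1 exprSr.
  by ring.
have nw : normc (w - w') = 6 / 5.
  have -> : w - w' = ((6 / 5)%:C)%C * Complex 0 1.
    rewrite /w /w'; simpc; apply/eqP; rewrite eq_complex/=.
    by apply/andP; split; apply/eqP; field.
  rewrite normcM normc_real ger0_norm//.
  by rewrite /normc expr0n expr1n add0r sqrtr1 mulr1.
set lhs := normc _; have -> : lhs = m%:R ^+ 2 * (p * q / normc al ^+ 2) * (6 / 5).
  rewrite /lhs !(normcM, normcNE, normcV, normcX) nw v1 (normc_nat R n) (normc_nat R m).
  rewrite pE -qE; field.
  by rewrite normc_eq0 al0 gt_eqF.
have p0 : 0 < p by rewrite pE divr_gt0// normc_gt0.
have q0 : 0 < q by rewrite qE normc_gt0.
apply: gap_estimate => //.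
- by rewrite ler_nat.
- by rewrite normc_gt0.
- exact: sqrtr_ge0.
- by rewrite sqr_sqrtr ?addr_ge0 ?sqr_ge0//; field.
Qed.

Lemma rho_lt_kobayashi X : X \in L R n 1 n -> X \notin L R n 1 1 -> X \notin L R n n n ->
  ((rho X)%:E < kobayashi G 0 X)%E.
Proof.
move=> /L_decomp[a [b ->]] X1 Xn.
have memL (c : C) j : c *: e R n j \in L R n j j.
  by rewrite /L memvZ// memv_span// !inE eqxx.
have b0 : b != 0.
  by apply: contraNneq X1 => ->; rewrite scale0r addr0 memL.
have a0 : a != 0.
  by apply: contraNneq Xn => ->; rewrite scale0r add0r memL.
apply: lt_le_trans (kobayashi_gap a0 b0 erefl erefl).
have nR0 : 0 < (n%:R : R) by rewrite ltr0n.
have p0 : 0 < normc a / n%:R by rewrite divr_gt0// normc_gt0.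
have q0 : 0 < normc b by rewrite normc_gt0.
rewrite lte_fin; apply: (@le_lt_trans _ _ (normc a / n%:R + normc b)); last first.
  rewrite ltrDl; apply: divr_gt0; apply: mulr_gt0 => //; exact: addr_gt0.
apply: rho_le => t t1; rewrite ler_pdivrMr// mulrDl divfK ?gt_eqF//.
rewrite linearD !linearZ/= !costara_num_e ?leqnn//.
apply: (le_trans (normcD_le _ _)).
rewrite -![_ *: _]/(_ * _) !normcM !normc_nat !normcX t1 !expr1n !mulr1.
by [].
Qed.

End StrictInequality.

Theorem theorem6p3 (R : realType) (n : nat) (hn : (2 <= n)%N)
    (k l : nat) (hk : (1 <= k <= n)%N) (hl : (1 <= l <= n)%N) :
  let G := symmetrized_polydisc R n in
  [/\ ((k %| n)%N -> kobayashi G 0 (e R n k) = (rho (e R n k))%:E)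
      /\ ((k %| n)%N -> (l %| n)%N ->
          forall X : 'rV[R[i]]_n, X \in L R n k l ->
            kobayashi_buseman G 0 X = caratheodory G 0 X
            /\ caratheodory G 0 X = (rho X)%:E),
      (3 <= n)%N ->
        forall X : 'rV[R[i]]_n,
          X \in L R n 1 n -> X \notin L R n 1 1 -> X \notin L R n n n ->
          ((rho X)%:E < kobayashi G 0 X)%E
    & ~~ (k %| n)%N ->
        ((rho (e R n k))%:E < caratheodory G 0 (e R n k))%E].
Proof.
move=> G; split.
- split=> [kn|kn ln X]; first by apply: kobayashi_e_dvd => //; exact: ltnW.
  by apply: metrics_agree_dvd => //; exact: ltnW.
- rewrite /G; case: n hn hk hl {G} => // m _ _ _ m2 X.
  exact: rho_lt_kobayashi.
- by apply: rho_lt_caratheodory_e => //; exact: ltnW.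
Qed.
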